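(* Let $p$ be a large prime number, $g$ a primitive root modulo $p$, and $a$ any integer coprime to $p$. For any integers $K,N,L,M$ with $$0<K+1\le K+N\le p-1,\qquad 0<L+1\le L+M\le p-1,$$ and any complex coefficients $\alpha_x$ and $\beta_y$ with $|\alpha_x|\le1$, $|\beta_y|\le 1$, the following inequality holds: $$\Big|\sum_{x=L+1}^{L+M}\sum_{y=K+1}^{K+N}\alpha_x\beta_y\,\mathbf{e}_p(ag^{xy})\Big|\ll (NM)^{5/8}p^{5/8+o(1)}.$$
   Context: $\mathbf{e}_p(z)=\exp(2\pi i z/p)$. The symbol $\ll$ is Vinogradov's symbol, and $o(1)$ refers to $p\to\infty$, uniformly in all other parameters: that is, for every $\eta>0$ there is a constant $C(\eta)$ depending only on $\eta$ such that the left side is at most $C(\eta)(NM)^{5/8}p^{5/8+\eta}$ for all admissible $p,g,a,K,N,L,M,\alpha,\beta$. *)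

(* Defs.v *)
From HB Require Import structures.
From mathcomp Require Export all_boot all_order all_algebra.
From mathcomp Require Export complex.
From mathcomp Require Export reals sequences exp trigo.

Set Implicit Arguments.
Unset Strict Implicit.
Unset Printing Implicit Defensive.

Import Order.TTheory GRing.Theory Num.Theory.
Local Open Scope ring_scope.
Local Open Scope complex_scope.

(* The library has no exponential on [R[i]]; this is
   exp (x + i y) = e^x (cos y + i sin y). *)
Definition cexp (R : realType) (z : R[i]) : R[i] :=
  (expR (complex.Re z))%:C * (cos (complex.Im z) +i* sin (complex.Im z)).

Definition ep (R : realType) (p : nat) (z : R[i]) : R[i] :=
  cexp (2 * (pi : R)%:C * (0 +i* 1) * z / p%:R).

(* For [p] prime, ['F_p] is Z/pZ, and the residue class of [g] is required to
   have multiplicative order exactly [p - 1] there. *)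
Definition primitive_root_mod (p : nat) (g : int) : bool :=
  p.-1.-primitive_root (g%:~R : 'F_p).

(* Main.v *)
(** Cauchy-Schwarz in y, with y completed to all residues modulo p - 1, leaves
    sum_y |sum_x alpha_x e_p(a g^(xy))|^2, and x is split according to
    d = gcd(x, p - 1).  In such a class x = d u with u a unit modulo
    t = (p - 1)/d, and dilating y by k/u for all units k <= D turns the sum
    into an average over k of correlations sum_v e_p(a (h^(kv) - h^(lv))),
    h = g^d, to which Weil's bound for binomials of degree d D applies; the
    choice D = p^(3/4) / (d sqrt(#u)) balances diagonal and off-diagonal
    terms.  The number of classes and the loss in restricting k to units are
    O(p^eta) by the divisor bound.

    Weil's bound |sum_x psi(f(x))| <= (deg f - 1) sqrt p is obtained as usual
    from the L-function of psi o f, a polynomial of degree deg f - 1 whose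
    inverse roots omega_i satisfy S_j = - sum_i omega_i^j, where S_j is the
    corresponding sum over F_(p^j); Bombieri's version of Stepanov's method on
    y^p - y = f(x) gives S_(2s) = O(p^s), which forces |omega_i|^2 <= p. *)

Require Import Defs.
From HB Require Import structures.
From mathcomp Require Import all_boot all_order all_algebra all_fingroup.
From mathcomp Require Import finfield closed_field separable boolp.
From mathcomp Require Import complex.
From mathcomp Require Import reals sequences exp trigo.
From mathcomp Require Import ring lra zify.

Set Implicit Arguments.
Unset Strict Implicit.
Unset Printing Implicit Defensive.

Import Order.TTheory GRing.Theory Num.Theory.
Import ComplexField.Normc.
Local Open Scope ring_scope.

(** * Newton's identities and an elementary inequality *)

(** Opening the square over a class at once would give binomials of degree up to p - 1, for which
    Weil's bound is worse than the trivial one. Dilating by a unit permutes the v modulo t, so the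
    multipliers u can be traded for small k, and the degree drops to d D.

    Up to p^eta, a class of m values u contributes m^(3/2) p^(5/4) to the sum over y. The square of
    the bilinear form is thus about N M^(3/2) p^(5/4). Since x and y play symmetric parts one may
    take M <= N, and then N M^(3/2) <= (NM)^(5/4): this is where both exponents 5/8 come from.

    Stepanov's method bounds numbers of points only from above. It is applied to every fibre of the
    trace of f(x). The p fibres have p^(2s) elements together, so their shortfalls from a common
    upper bound have a known total, and this total bounds S_(2s) without a lower bound for any
    fibre. *)

Lemma newton_prod (A : comNzRingType) (rs : seq A) (j : nat) :
  (\prod_(r <- rs) (1 - r *: 'X))`_j *+ j =
  - \sum_(i < j) (\sum_(r <- rs) r ^+ i.+1) *
      (\prod_(r <- rs) (1 - r *: 'X))`_(j - i.+1).
Proof.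
elim: rs j => [|r rs IH] j.
  rewrite big_nil coef1 big1 ?oppr0; first by case: j => // j; rewrite mul0rn.
  by move=> i _; rewrite big_nil mul0r.
rewrite big_cons; set L := \prod_(r0 <- rs) _ in IH *.
have co k : ((1 - r *: 'X) * L)`_k = L`_k - r * (if k is k'.+1 then L`_k' else 0).
  by rewrite mulrBl mul1r coefB -scalerAl coefZ [_`_k in X in _ - X]coefXM; case: k.
case: j => [|j]; first by rewrite mulr0n big_ord0 oppr0.
rewrite co mulrnBl IH.
under [X in _ = - X]eq_bigr => i _ do rewrite big_cons co mulrDl addrC.
rewrite big_split opprD /=.
have -> : \sum_(i < j.+1) (\sum_(s <- rs) s ^+ i.+1) *
   (L`_(j.+1 - i.+1) - r * (match (j.+1 - i.+1)%N with k'.+1 => L`_k' | _ => 0 end))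
  = \sum_(i < j.+1) (\sum_(s <- rs) s ^+ i.+1) * L`_(j.+1 - i.+1)
   - r * \sum_(i < j) (\sum_(s <- rs) s ^+ i.+1) * L`_(j - i.+1).
  under eq_bigr do rewrite mulrBr.
  rewrite sumrB; congr (_ - _).
  rewrite big_ord_recr /= subnn !mulr0 addr0 mulr_sumr.
  apply: eq_bigr => i _.
  by rewrite subSS -(subnSK (ltn_ord i)) mulrCA.
(* The powers of the new root r telescope; only the term r L_j at i = 0 is left. *)
have -> : \sum_(i < j.+1) r ^+ i.+1 *
   (L`_(j.+1 - i.+1) - r * (match (j.+1 - i.+1)%N with k'.+1 => L`_k' | _ => 0 end))
   = r * L`_j.
  under eq_bigr do rewrite mulrBr.
  rewrite sumrB big_ord_recl [X in _ - X]big_ord_recr /= subnn !mulr0 addr0 expr1 subn1 /=.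
  rewrite -addrA -sumrB big1 ?addr0 // => i _.
  rewrite /bump /= add1n !subSS -(subnSK (ltn_ord i)) [_ ^+ i.+2]exprSr.
  by rewrite mulrA subrr.
have := IH j; set s1 := \sum_(i < j) _ => /(congr1 (fun z => r * z)).
rewrite mulrN -mulrnAr => e; rewrite mulrSr [r * (_ + _)]mulrDr e; ring.
Qed.

Lemma size_prod_1subZX (A : comNzRingType) (rs : seq A) :
  (size (\prod_(r <- rs) (1 - r *: 'X))%R <= (size rs).+1)%N.
Proof.
elim: rs => [|s t IHt]; first by rewrite big_nil size_poly1.
rewrite big_cons; apply: leq_trans (size_polyMleq _ _) _.
have : (size (1 - s *: 'X : {poly A})%R <= 2)%N.
  rewrite (leq_trans (size_polyD _ _)) // size_poly1 size_polyN geq_max /=.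
  by rewrite (leq_trans (size_scale_leq _ _)) // size_polyX.
move: IHt => /= IHt h; move: (leq_add h IHt).
by rewrite -subn1 leq_subLR => /leq_trans -> //; lia.
Qed.

(** Newton's identities concern prod (1 - r X), while factoring over a closed field yields prod (X -
    r). The two are reciprocal polynomials. *)
Lemma prod_XsubC_coef_rev (A : comNzRingType) (rs : seq A) (j : nat) :
  (j <= size rs)%N ->
  (\prod_(r <- rs) ('X - r%:P))`_(size rs - j) =
  (\prod_(r <- rs) (1 - r *: 'X))`_j.
Proof.
elim: rs j => [|r rs IH] j.
  by rewrite leqn0 => /eqP ->; rewrite !big_nil !coef1.
have sL k : (size rs < k)%N -> (\prod_(r <- rs) (1 - r *: 'X))`_k = 0.
  by move=> kn; apply: nth_default; apply: leq_trans kn; apply: size_prod_1subZX.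
rewrite !big_cons /=; set h := \prod_(_ <- _) ('X - _); set L := \prod_(_ <- _) (_ - _).
rewrite -/L in sL.
move=> jn; rewrite !mulrBl mul1r !coefB coefXM coefCM -scalerAl coefZ.
rewrite [('X * L)`_j]coefXM.
case: j jn => [|j] jn.
  rewrite subn0 /= mulr0 subr0 -(IH 0%N) // subn0 /h.
  by rewrite [X in _ - r * X]nth_default ?mulr0 ?subr0 // size_prod_XsubC.
rewrite subSS /= -(IH j) // subn_eq0.
have [jn'|jn'] := leqP (size rs) j; last by rewrite -IH // subnS.
have -> : j = size rs by apply/eqP; rewrite eqn_leq -ltnS jn.
by rewrite subnn sL.
Qed.

Lemma bernoulli_ineq (R : realFieldType) (x : R) (n : nat) : 0 <= x ->
  1 + n%:R * x <= (1 + x) ^+ n.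
Proof.
move=> x0; elim: n => [|n IH]; first by rewrite mul0r addr0 expr0.
rewrite exprS -natr1; have n0 : 0 <= n%:R :> R by [].
move: IH n0; move: ((1 + x) ^+ n) (n%:R : R) => w v IH v0.
have h1 : 0 <= x * (w - (1 + v * x)) by rewrite mulr_ge0 // subr_ge0.
have h2 : 0 <= v * (x * x) by rewrite !mulr_ge0.
by nra.
Qed.

(** * Bombieri's auxiliary function on an Artin-Schreier curve *)

Lemma sum_neq0 (V : nmodType) (I : finType) (F : I -> V) :
  \sum_i F i != 0 -> exists i, F i != 0.
Proof.
move=> nz; apply/existsP; apply: contraNT nz; rewrite negb_exists => /forallP h.
by rewrite big1 // => i _; apply/eqP; rewrite -[_ == _]negbK; apply: h.
Qed.

(** One division step by y^p - y - f, with a = y^(k-p), b = y^p and g = f, isolated in an abstract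
    ring. *)
Lemma modulus_shift (A : comNzRingType) (U u a b y g : A) :
  U - u * (a * b) + u * a * (y + g) = U - u * a * (b - y - g).
Proof. by ring. Qed.

Lemma leq_ord_pred n (i : 'I_n) : (i <= n.-1)%N.
Proof. by rewrite -ltnS prednK ?ltn_ord //; case: n i => [[]|]. Qed.

Section WeightedReduction.

Variables (p : nat) (p_pr : prime p) (f : {poly 'F_p}) (d : nat).
Hypotheses (d_gt0 : (0 < d)%N) (size_f : size f = d.+1).
Variables (K : fieldType) (iota : {rmorphism 'F_p -> K}).
Local Notation F := 'F_p.

(* The inner variable is x, the outer one is y.  The weights p of x and d of y
   are the pole orders at infinity on the curve y^p - y = f(x). *)
Definition weight_le (m : nat) (U : {poly {poly F}}) :=
  forall j i, U`_j`_i != 0 -> (p * i + d * j <= m)%N.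

Definition eval2 (x y : K) : {poly {poly F}} -> K :=
  horner_eval y \o map_poly (horner_eval x \o map_poly iota).

HB.instance Definition _ x y := GRing.RMorphism.on (eval2 x y).

(* The substitution x := T^p, y := f_d T^d.  Since f_d^p = f_d, it cancels the
   part of weight p d of y^p - y - f, so that the coefficient of T^m of a
   polynomial of weight at most m survives reduction modulo y^p - y - f. *)
Definition leading_form : {poly {poly F}} -> {poly F} :=
  horner_eval (lead_coef f *: 'X^d) \o map_poly (comp_poly 'X^p).

HB.instance Definition _ := GRing.RMorphism.on leading_form.

Lemma weight_leW m n U : (m <= n)%N -> weight_le m U -> weight_le n U.
Proof. by move=> mn wU j i /wU /leq_trans; apply. Qed.

Lemma weight_leD m U V : weight_le m U -> weight_le m V -> weight_le m (U + V).
Proof.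
move=> wU wV j i; rewrite !coefD; have [->|/wU //] := eqVneq (U`_j`_i) 0.
by rewrite add0r => /wV.
Qed.

Lemma weight_le0 m : weight_le m 0.
Proof. by move=> j i; rewrite !coef0 eqxx. Qed.

Lemma weight_le_sum m (I : Type) (r : seq I) (P : pred I) (U : I -> {poly {poly F}}) :
  (forall i, P i -> weight_le m (U i)) -> weight_le m (\sum_(i <- r | P i) U i).
Proof.
move=> wU; elim/big_rec: _ => [|i V Pi wV]; first exact: weight_le0.
exact/weight_leD/wV/wU.
Qed.

Lemma weight_leM m n U V :
  weight_le m U -> weight_le n V -> weight_le (m + n) (U * V).
Proof.
move=> wU wV j i; rewrite coefM coef_sum => nz.
have [k] := sum_neq0 nz; rewrite coefM => /sum_neq0[l].
rewrite mulf_eq0 negb_or => /andP[/wU h1 /wV h2].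
have lk := ltn_ord k; have ll := ltn_ord l.
have -> : (p * i + d * j = (p * l + d * k) + (p * (i - l) + d * (j - k)))%N by nia.
exact: leq_add.
Qed.

Lemma weight_leC (c : F) : weight_le 0 c%:P%:P.
Proof. by case=> [|j] [|i]; rewrite !coefC /= ?coefC ?coef0 ?eqxx ?muln0. Qed.

Lemma weight_le_coef m (u : {poly F}) : (forall i, u`_i != 0 -> (p * i <= m)%N) -> weight_le m u%:P.
Proof. by move=> h [|j] i; rewrite coefC /= ?coef0 ?eqxx // muln0 addn0 => /h. Qed.

Lemma weight_leX : weight_le p ('X)%:P.
Proof.
apply: weight_le_coef => i; rewrite coefX; case: (i =P 1%N) => [->|_]; rewrite ?muln1 ?eqxx //.
Qed.

Lemma weight_leY : weight_le d 'X.
Proof.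
move=> j i; rewrite coefX; case: (j =P 1%N) => [->|_]; last by rewrite coef0 eqxx.
by case: i => [|i]; rewrite ?coef1 ?muln0 ?muln1 //= eqxx.
Qed.

Lemma weight_leXn m U n : weight_le m U -> weight_le (m * n) (U ^+ n).
Proof.
move=> wU; elim: n => [|n IH]; first by rewrite expr0 muln0; apply: weight_leC.
by rewrite exprS mulnS; apply: weight_leM.
Qed.

Lemma leading_formE U :
  leading_form U =
  \sum_(j < size U) \sum_(i < size U`_j)
     (U`_j`_i * lead_coef f ^+ j) *: 'X^(p * i + d * j).
Proof.
rewrite /leading_form /= /horner_eval horner_poly.
apply: eq_bigr => j _; rewrite comp_polyE mulr_suml; apply: eq_bigr => i _.
rewrite exprZn -!exprM -scalerAl -scalerAr scalerA exprD.
by [].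
Qed.

Lemma size_leading_form m U : weight_le m U -> (size (leading_form U) <= m.+1)%N.
Proof.
move=> wU; rewrite leading_formE (leq_trans (size_sum _ _ _)) //.
apply/bigmax_leqP => j _; rewrite (leq_trans (size_sum _ _ _)) //.
apply/bigmax_leqP => i _.
have [->|nz] := eqVneq (U`_j`_i) 0; first by rewrite mul0r scale0r size_poly0.
by rewrite (leq_trans (size_scale_leq _ _)) // size_polyXn ltnS wU.
Qed.

Definition as_modulus : {poly {poly F}} := 'X^p - 'X - f%:P.

Lemma Fp_expp (c : F) : c ^+ p = c.
Proof. by have := expf_card c; rewrite card_Fp. Qed.

Lemma size_leading_form_modulus : (size (leading_form as_modulus) <= p * d)%N.
Proof.
have p_gt1 := prime_gt1 p_pr.
have lf : leading_form f%:P = f \Po 'X^p.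
  by rewrite /leading_form /= /horner_eval map_polyC hornerC.
have lX : leading_form 'X = lead_coef f *: 'X^d.
  by rewrite /leading_form /= /horner_eval map_polyX hornerX.
rewrite /as_modulus !rmorphB rmorphXn /= lX lf exprZn Fp_expp -exprM.
(* Once the terms in T^(pd) cancel, what remains is f_d T^d and g(T^p), both of degree below pd. *)
pose g := f - lead_coef f *: 'X^d.
have sg : (size g <= d)%N.
  apply/leq_sizeP => j dj; rewrite coefB coefZ coefXn.
  move: dj; rewrite leq_eqVlt => /predU1P[<-|dj].
    by rewrite eqxx mulr1 lead_coefE size_f subrr.
  by rewrite nth_default ?size_f // gtn_eqF // mulr0 subrr.
have -> : f \Po 'X^p = lead_coef f *: 'X^(d * p) + (g \Po 'X^p).
  by rewrite -{1}[f](subrK (lead_coef f *: 'X^d)) -/g comp_polyD comp_polyZ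
     comp_Xn_poly -exprM [(p * d)%N]mulnC addrC.
rewrite opprD addrA [X in X - _]addrAC subrr sub0r -opprD size_polyN.
rewrite (leq_trans (size_polyD _ _)) // geq_max; apply/andP; split.
  rewrite (leq_trans (size_scale_leq _ _)) // size_polyXn.
  by rewrite -[d.+1]add1n; nia.
have [-> | gn0] := eqVneq g 0; first by rewrite comp_poly0 size_poly0.
have := size_comp_poly g ('X^p : {poly F}); rewrite size_polyXn /= => e.
have : (0 < size g)%N by rewrite size_poly_gt0.
move: e sg; move: (size (g \Po 'X^p)) (size g) => s [|n] //= e nd _.
have : (p * n.+1 <= p * d)%N by rewrite leq_mul2l nd orbT.
by rewrite mulnS mulnC -e; lia.
Qed.

Lemma eval2E x y U :
  eval2 x y U = (map_poly (horner_eval x \o map_poly iota) U).[y].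
Proof. by []. Qed.

Lemma eval2Y x y : eval2 x y 'X = y.
Proof. by rewrite eval2E map_polyX hornerX. Qed.

Lemma eval2C x y u : eval2 x y u%:P = (map_poly iota u).[x].
Proof. by rewrite eval2E map_polyC hornerC. Qed.

Lemma eval2_modulus x y :
  y ^+ p - y = (map_poly iota f).[x] -> eval2 x y as_modulus = 0.
Proof.
move=> e; rewrite /as_modulus !rmorphB rmorphXn /=.
by rewrite eval2Y eval2C e subrr.
Qed.

(** Division by y^p - y - f in y. A step replaces u y^k by u y^(k-p) (y + f), which does not raise
    the weight because y and f weigh at most pd, the weight of y^p. The multiple W of the modulus
    that is removed has weight of W at most m - pd, so its leading form has degree below m and the
    coefficient of T^m is untouched. *)
Lemma weight_reduce m U : weight_le m U ->
  exists R : {poly {poly F}},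
    [/\ (size R <= p)%N, weight_le m R, (leading_form R)`_m = (leading_form U)`_m
      & forall x y, y ^+ p - y = (map_poly iota f).[x] -> eval2 x y R = eval2 x y U].
Proof.
have [n] := ubnP (size U); elim: n U => // n IH U sU wU.
have [sUp|pU] := leqP (size U) p; first by exists U.
pose k := (size U).-1; have k1 : size U = k.+1 by rewrite /k prednK //; apply: leq_trans pU.
have pk : (p <= k)%N by rewrite -ltnS -k1.
pose u := lead_coef U.
have wu i : u`_i != 0 -> (p * i + d * k <= m)%N.
  by move=> nz; apply: wU; rewrite -lead_coefE.
pose W : {poly {poly F}} := u%:P * 'X^(k - p).
pose U1 := (U - u%:P * 'X^k) + W * ('X + f%:P).
have U1E : U1 = U - W * as_modulus.
  rewrite /U1 /as_modulus -[in 'X^k](subnK pk) exprD /W; apply: modulus_shift.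
have un0 : u != 0 by rewrite lead_coef_eq0 -size_poly_gt0 (leq_trans _ pU).
(* Ensures that the subtraction m - pd below is not truncated. *)
have mpd : (p * d <= m)%N.
  have [i nz] : exists i, u`_i != 0 by exists (size u).-1; rewrite -lead_coefE lead_coef_eq0.
  by rewrite mulnC (leq_trans _ (wu i nz)) // -[(d * p)%N]add0n leq_add // leq_mul2l pk orbT.
have wW : weight_le (m - p * d) W.
  move=> j i; rewrite /W coefMXn; case: ltnP => [_|kj]; first by rewrite coef0 eqxx.
  rewrite coefC subn_eq0; case: leqP => [jk|]; last by rewrite coef0 eqxx.
  move=> /wu h; have -> : j = (k - p)%N by apply/eqP; rewrite eqn_leq jk kj.
  have : (d * p <= d * k)%N by rewrite leq_mul2l pk orbT.
  by rewrite leq_subRL // mulnBr [(p * d)%N]mulnC; lia.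
have sU1 : (size U1 < n)%N.
  rewrite (@leq_ltn_trans k) //; last by rewrite -ltnS -k1.
  rewrite (leq_trans (size_polyD _ _)) // geq_max; apply/andP; split.
    apply/leq_sizeP => j; rewrite leq_eqVlt coefB coefMXn => /predU1P[<-|kj].
      by rewrite ltnn subnn coefC eqxx /u lead_coefE k1 subrr.
    by rewrite nth_default ?k1 // ltnNge ltnW //= coefC subn_eq0 leqNgt kj subrr.
  rewrite (leq_trans (size_polyMleq _ _)) // size_XaddC.
  have : (size W <= (k - p).+1)%N.
    rewrite (leq_trans (size_polyMleq _ _)) // size_polyXn size_polyC.
    by case: (u != 0).
  by have := prime_gt1 p_pr; move: (size W) => sW; lia.
have wU1 : weight_le m U1.
  apply: weight_leD.
    move=> j i; rewrite coefB coefMXn coefC subn_eq0.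
    have [jk|kj|->] := ltngtP j k; first by rewrite subr0; apply: wU.
      by rewrite subr0; apply: wU.
    by rewrite /u lead_coefE k1 subrr coef0 eqxx.
  rewrite -(subnK mpd); apply: weight_leM => //; apply: weight_leD.
    by apply: weight_leW weight_leY; rewrite leq_pmull ?prime_gt0.
  apply: weight_le_coef => i nz; rewrite leq_mul2l -ltnS -size_f.
  by rewrite ltnNge (contraNN _ nz) ?orbT // => /(nth_default 0) ->.
have [R [sR wR lR eR]] := IH _ sU1 wU1.
exists R; split=> // [|x y e].
  rewrite lR U1E rmorphB rmorphM coefB [X in _ - X]nth_default ?subr0 //.
  rewrite (leq_trans (size_polyMleq _ _)) //.
  have := size_leading_form wW; have := size_leading_form_modulus.
  by move: mpd; move: (size _) (size _) => a b; lia.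
by rewrite eR // U1E rmorphB rmorphM /= (eval2_modulus e) mulr0 subr0.
Qed.

(** The weight modulo p determines d j, hence j, since p does not divide d and j < p. So distinct
    monomials of y-degree below p have distinct pole orders. *)
Lemma weight_inj (i i' : nat) (j j' : 'I_p) : ~~ (p %| d)%N ->
  (p * i + d * j = p * i' + d * j')%N -> i = i' /\ j = j'.
Proof.
move=> pd e.
have ejj : j = j'.
  apply/val_inj => /=; move: (congr1 (modn^~ p) e).
  rewrite ![(p * _)%N]mulnC !modnMDl => /eqP.
  wlog jj' : j j' {e} / (j' <= j)%N => [hw h|].
    by case/orP: (leq_total j' j) => jj; [|apply/esym]; apply: hw => //; rewrite eq_sym.
  rewrite eqn_mod_dvd ?leq_mul2l ?jj' ?orbT // -mulnBr Euclid_dvdM // (negbTE pd) /=.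
  rewrite dvdn_eq divn_small /= ?mul0n; last by apply: leq_ltn_trans (leq_subr _ _) (ltn_ord _).
  by rewrite eq_sym subn_eq0 => jj; apply/eqP; rewrite eqn_leq jj jj'.
split=> //; apply/eqP; move: e; rewrite ejj => /addIn /eqP.
by rewrite eqn_pmul2l ?prime_gt0.
Qed.

Lemma expr_sum_pchar (I : Type) (r : seq I) (P : pred I) (G : I -> K) (s : nat) :
  (\sum_(i <- r | P i) G i) ^+ (p ^ s) = \sum_(i <- r | P i) G i ^+ (p ^ s).
Proof.
have pK : p \in [pchar K] by rewrite (rmorph_pchar iota) // pchar_Fp.
apply: (big_morph (fun x => x ^+ (p ^ s))) => [x y|].
  by rewrite exprDn_pchar // pnatX (pnatE _ p_pr) pK.
by rewrite expr0n expn_eq0; case: p p_pr.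
Qed.

(** Provides the finite box of p I3 coefficients into which the pigeonhole argument maps reduced
    polynomials. *)
Lemma weight_box_eq m I3 (R R' : {poly {poly F}}) :
  (size R <= p)%N -> (size R' <= p)%N -> weight_le m R -> weight_le m R' ->
  (m < p * I3)%N ->
  (forall u : 'I_p * 'I_I3, R`_(u.1)`_(u.2) = R'`_(u.1)`_(u.2)) -> R = R'.
Proof.
move=> sR sR' wR wR' hI3 e; apply/polyP => j; apply/polyP => i.
have [jp|jp] := ltnP j p; last first.
  have dj (V : {poly {poly F}}) : (size V <= p)%N -> V`_j = 0.
    by move=> sV; apply: nth_default; apply: leq_trans sV jp.
  by rewrite (dj R sR) (dj R' sR').
have [iI|iI] := ltnP i I3; first exact: (e (Ordinal jp, Ordinal iI)).
have mi : (m < p * i + d * j)%N.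
  by apply: leq_trans hI3 (leq_trans _ (leq_addr _ _)); rewrite leq_mul2l iI orbT.
have nz (V : {poly {poly F}}) : weight_le m V -> V`_j`_i = 0.
  by move=> wV; apply/eqP; apply/negPn/negP => /wV; rewrite leqNgt mi.
by rewrite (nz R wR) (nz R' wR').
Qed.

Section Stepanov.

Variables (Q I1 I2 I3 : nat) (c : F).
Let idx := (('I_I2 * 'I_p) * ('I_I1 * 'I_p))%type.

(* At a point of the curve with x^(Q^2) = x and y^(Q^2) = y + c, the Q-th power
   of [aux_poly b] takes the value of [frob_aux b].  The latter has small
   weight, so by counting some b <> 0 makes it vanish on the whole curve. *)
Definition frob_aux (b : {ffun idx -> F}) : {poly {poly F}} :=
  \sum_z (b z)%:P%:P *
    ('X%:P ^+ (z.2.1 * Q + z.1.1) * 'X ^+ (z.2.2 * Q) * ('X + c%:P%:P) ^+ z.1.2).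

Definition aux_poly (b : {ffun idx -> F}) : {poly {poly F}} :=
  \sum_z (b z)%:P%:P * ('X%:P ^+ (z.2.1 + z.1.1 * Q) * 'X ^+ (z.2.2 + z.1.2 * Q)).

Definition aux_weight (z : idx) : nat :=
  (p * z.2.1 + d * z.2.2 + Q * (p * z.1.1 + d * z.1.2))%N.

Let m1 := (p * I1.-1 + d * p.-1)%N.
Let m2 := (p * I2.-1 + d * p.-1)%N.

Lemma low_weight_le (z : idx) : (p * z.2.1 + d * z.2.2 <= m1)%N.
Proof.
by apply: leq_add; rewrite leq_mul2l leq_ord_pred orbT.
Qed.

Lemma high_weight_le (z : idx) : (p * z.1.1 + d * z.1.2 <= m2)%N.
Proof.
by apply: leq_add; rewrite leq_mul2l leq_ord_pred orbT.
Qed.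

Lemma weight_le_frob_aux b : weight_le (Q * m1 + m2) (frob_aux b).
Proof.
apply: weight_le_sum => z _; rewrite -[(Q * _ + _)%N]add0n.
apply: weight_leM; first exact: weight_leC.
apply: (@weight_leW (p * (z.2.1 * Q + z.1.1) + d * (z.2.2 * Q) + d * z.1.2)%N).
  have := leq_add (leq_mul (leqnn Q) (low_weight_le z)) (high_weight_le z).
  by apply: leq_trans; rewrite leq_eqVlt; apply/orP; left; apply/eqP; ring.
apply: weight_leM; last first.
  by apply: weight_leXn; apply: weight_leD; [exact: weight_leY | apply: (@weight_leW 0%N) => //; apply: weight_leC].
by apply: weight_leM; apply: weight_leXn; [exact: weight_leX|exact: weight_leY].
Qed.

Lemma weight_aux_term z (v : F) :
  weight_le (aux_weight z)
    (v%:P%:P * ('X%:P ^+ (z.2.1 + z.1.1 * Q) * 'X ^+ (z.2.2 + z.1.2 * Q))).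
Proof.
rewrite -[aux_weight z]add0n; apply: weight_leM; first exact: weight_leC.
have -> : aux_weight z = (p * (z.2.1 + z.1.1 * Q) + d * (z.2.2 + z.1.2 * Q))%N.
  by rewrite /aux_weight; ring.
by apply: weight_leM; apply: weight_leXn; [exact: weight_leX|exact: weight_leY].
Qed.

(** As m1 < Q, the low and high parts are quotient and remainder of the weight by Q; [weight_inj]
    then recovers the exponents from each part. *)
Lemma aux_weight_inj : ~~ (p %| d)%N -> (m1 < Q)%N -> injective aux_weight.
Proof.
move=> pd m1Q z z' e.
have h := leq_ltn_trans (low_weight_le z) m1Q.
have h' := leq_ltn_trans (low_weight_le z') m1Q.
have Q0 : (0 < Q)%N by apply: leq_ltn_trans m1Q.
have elow : (p * z.2.1 + d * z.2.2 = p * z'.2.1 + d * z'.2.2)%N.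
  move: (congr1 (modn^~ Q) e); rewrite /aux_weight ![(Q * _)%N]mulnC ![(_ + _ * Q)%N]addnC !modnMDl.
  by rewrite !modn_small.
have ehigh : (p * z.1.1 + d * z.1.2 = p * z'.1.1 + d * z'.1.2)%N.
  by move: e; rewrite /aux_weight elow => /addnI /eqP; rewrite eqn_pmul2l // => /eqP.
have [e1 e2] := weight_inj pd elow; have [e3 e4] := weight_inj pd ehigh.
case: z z' e1 e2 e3 e4 {e h h' elow ehigh} => [[k l] [i j]] [[k' l'] [i' j']] /=.
by move=> /val_inj -> -> /val_inj -> ->.
Qed.

Lemma leading_form_term (z : idx) (v : F) :
  leading_form (v%:P%:P * ('X%:P ^+ (z.2.1 + z.1.1 * Q) * 'X ^+ (z.2.2 + z.1.2 * Q))) =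
  (v * lead_coef f ^+ (z.2.2 + z.1.2 * Q)) *: 'X^(aux_weight z).
Proof.
have lfC u : leading_form u%:P = u \Po 'X^p.
  by rewrite /leading_form /= /horner_eval map_polyC hornerC.
have lfX : leading_form 'X = lead_coef f *: 'X^d.
  by rewrite /leading_form /= /horner_eval map_polyX hornerX.
rewrite !rmorphM !rmorphXn /= lfX !lfC comp_polyC comp_polyX exprZn -!exprM.
rewrite mul_polyC -scalerAr scalerA -exprD; congr (_ *: 'X^_).
by rewrite /aux_weight; ring.
Qed.

(** Some non-zero b makes [frob_aux b] vanish on the curve, hence [aux_poly b] vanish at all the
    given points. Yet the monomials of [aux_poly b] have distinct weights, so its leading form, and
    therefore its reduction, is non-zero. A non-zero y-coefficient of this reduction has every x in
    [rs] as a root, and its degree is limited by the weight m1 + Q m2. *)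
Lemma stepanov (s : nat) (rs : seq K) : Q = (p ^ s)%N ->
  ~~ (p %| d)%N -> (m1 < Q)%N -> (Q * m1 + m2 < p * I3)%N -> (I3 < I2 * p * I1)%N ->
  uniq rs ->
  {in rs, forall x, x ^+ (Q * Q) = x /\
     exists ys, [/\ uniq ys, size ys = p &
       {in ys, forall y, y ^+ p - y = (map_poly iota f).[x] /\ y ^+ (Q * Q) = y + iota c}]} ->
  (p * size rs <= m1 + Q * m2)%N.
Proof.
move=> Qp pd m1Q hI3 hI urs hrs.
have p0 := prime_gt0 p_pr.
have redE b : exists R : {poly {poly F}},
     [/\ (size R <= p)%N, weight_le (Q * m1 + m2) R
      & forall x y, y ^+ p - y = (map_poly iota f).[x] ->
          eval2 x y R = eval2 x y (frob_aux b)].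
  have [R [sR wR _ eR]] := weight_reduce (@weight_le_frob_aux b).
  by exists R.
have [red hred] := choice redE.
pose Theta (b : {ffun idx -> F}) : {ffun 'I_p * 'I_I3 -> F} :=
  [ffun u : 'I_p * 'I_I3 => (red b)`_(u.1)`_(u.2)].
(* Pigeonhole: there are p I1 I2 p free coefficients and only p I3 < p I1 I2 p coefficients after
   reduction. *)
have : ~~ injectiveb Theta.
  apply/negP => /injectiveP /leq_card; rewrite !card_ffun card_Fp // !card_prod !card_ord.
  rewrite leq_exp2l ?prime_gt1 // leqNgt => /negP[].
  have -> : (I2 * p * (I1 * p) = p * (I2 * p * I1))%N by ring.
  by rewrite ltn_pmul2l.
case/injectivePn => b [b' bb' eT].
have eR : red b = red b'.
  have [sR wR _] := hred b; have [sR' wR' _] := hred b'.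
  apply: (weight_box_eq sR sR' wR wR' hI3) => u.
  by have /ffunP/(_ u) := eT; rewrite ffunE ffunE.
pose e := [ffun z => b z - b' z] : {ffun idx -> F}.
have e0 : exists z, e z != 0.
  apply/existsP; apply: contraNT bb'; rewrite negb_exists => /forallP h.
  by apply/eqP/ffunP => z; apply/eqP; move: (h z); rewrite negbK ffunE subr_eq0.
have Ue x y : y ^+ p - y = (map_poly iota f).[x] -> eval2 x y (frob_aux e) = 0.
  move=> exy; have -> : frob_aux e = frob_aux b - frob_aux b'.
    rewrite /frob_aux -sumrB; apply: eq_bigr => z _.
    by rewrite ffunE !polyCB mulrBl.
  have [_ _ h] := hred b; have [_ _ h'] := hred b'.
  by rewrite rmorphB /= -(h x y exy) -(h' x y exy) eR subrr.
have Psie x y : y ^+ p - y = (map_poly iota f).[x] -> x ^+ (Q * Q) = x ->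
    y ^+ (Q * Q) = y + iota c -> eval2 x y (aux_poly e) = 0.
  move=> exy xQ yQ; have Q0 : (0 < Q)%N by rewrite Qp expn_gt0 p0.
  have : eval2 x y (aux_poly e) ^+ Q = 0; last by move/eqP; rewrite expf_eq0 Q0 => /eqP.
  rewrite -(Ue x y exy) /aux_poly /frob_aux !rmorph_sum [in LHS]Qp expr_sum_pchar.
  apply: eq_bigr => z _; rewrite -Qp !rmorphM !rmorphXn rmorphD /= eval2Y !eval2C.
  rewrite !map_polyC map_polyX !hornerC hornerX !exprMn -!exprM -rmorphXn.
  have -> : e z ^+ Q = e z.
    rewrite Qp; elim: (s) => [|n IH]; first by rewrite expr1.
    by rewrite expnS exprM Fp_expp.
  congr (_ * _); rewrite -mulrA; congr (_ * _).
    by rewrite mulnDl exprD -mulnA (mulnC z.1.1) [x ^+ (_ * z.1.1)]exprM xQ -exprD.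
  by rewrite mulnDl exprD -mulnA (mulnC z.1.2) [y ^+ (_ * z.1.2)]exprM yQ.
have [z0 ez0] := e0.
(* The monomial of largest weight that occurs; no other one reaches this weight, so it alone
   produces the leading coefficient. *)
pose z1 := [arg max_(z > z0 | e z != 0) aux_weight z].
have [ez1 z1max] : e z1 != 0 /\ forall z, e z != 0 -> (aux_weight z <= aux_weight z1)%N.
  by rewrite /z1; case: arg_maxnP.
have wPsi : weight_le (aux_weight z1) (aux_poly e).
  apply: weight_le_sum => z _; have [->|ez] := eqVneq (e z) 0.
    by rewrite mul0r; apply: weight_le0.
  exact: weight_leW (z1max _ ez) (@weight_aux_term _ _).
have lPsi : (leading_form (aux_poly e))`_(aux_weight z1) != 0.
  rewrite rmorph_sum /= coef_sum (bigD1 z1) //= big1 ?addr0 => [|z zz1].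
    rewrite leading_form_term coefZ coefXn eqxx mulr1 mulf_neq0 ?expf_neq0 //.
    by rewrite lead_coef_eq0 -size_poly_eq0 size_f.
  by rewrite leading_form_term coefZ coefXn (inj_eq (aux_weight_inj pd m1Q)) eq_sym
     (negbTE zz1) mulr0.
have [R [sR wR lR evR]] := weight_reduce wPsi.
have R0 : R != 0.
  by apply: contraNneq lPsi => R0; rewrite -lR R0 rmorph0 coef0.
have [j Rj] : exists j, R`_j != 0 by exists (size R).-1; rewrite -lead_coefE lead_coef_eq0.
have rootR x : x \in rs -> root (map_poly iota R`_j) x.
  move=> xrs; have [xQ [ys [uys sys hys]]] := hrs x xrs.
  (* For fixed x this polynomial in y has degree below p and the p points above x as roots, so all
     its coefficients vanish at x. *)
  pose P := map_poly (horner_eval x \o map_poly iota) R.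
  have P0 : P = 0.
    apply: (@roots_geq_poly_eq0 _ _ ys) => //; last first.
      by rewrite sys (leq_trans (size_poly _ _)).
    apply/allP => y /hys [yp yQ]; apply/eqP.
    by rewrite -eval2E evR // Psie.
  by have := congr1 (fun u : {poly K} => u`_j) P0; rewrite coef0 coef_map /= => /eqP.
have : (size rs < size (map_poly iota R`_j))%N.
  apply: max_poly_roots => //; first by rewrite map_poly_eq0.
  exact/allP.
rewrite size_map_poly => szrs.
have := wR j (size R`_j).-1; rewrite -lead_coefE lead_coef_eq0 Rj => /(_ isT) wj.
apply: leq_trans (_ : aux_weight z1 <= _)%N.
  apply: leq_trans wj; apply: leq_trans (leq_addr _ _).
  by rewrite leq_mul2l -ltnS prednK ?szrs ?orbT // (leq_ltn_trans _ szrs).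
by apply: leq_add; [apply: low_weight_le | rewrite leq_mul2l high_weight_le orbT].
Qed.

End Stepanov.

End WeightedReduction.

(** Here n is Q = p P, with I1 = P - d, I2 = P + d and I3 = p I1 I2 - 1. Then m1 = n - p - d, m2 = n
    + 2dp - p - d and p I3 = n^2 - p^2 d^2 - p. In the second inequality p + d >= 3 leaves a surplus
    of at least 2n, which pays for the n inside m2 and, by the hypothesis on n, for p^2 d^2 +
    2dp. *)
Lemma stepanov_parameters (p d n : nat) : (1 < p)%N -> (0 < d)%N ->
  (p * p * (d * d) + 2 * (d * p) <= n)%N ->
  [/\ (n - p - d < n)%N,
      (n * (n - p - d) + (n + 2 * d * p - p - d) < n * n - p * p * (d * d) - p)%N
    & (n - p - d + n * (n + 2 * d * p - p - d) <= n * n + n * (2 * d * p))%N].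
Proof.
move=> p1 d0 hn; have p0 : (0 < p)%N by lia.
have pu : (p <= p * p * (d * d))%N by rewrite -mulnA leq_pmulr // !muln_gt0 p0 d0.
have dv : (d <= d * p)%N by rewrite leq_pmulr.
have h3 : (n * 3 <= n * (p + d))%N by rewrite leq_mul2l; apply/orP; right; lia.
rewrite -[(2 * d * p)%N]mulnA; move: hn pu dv; move: (p * p * _)%N (d * p)%N => u v hn pu dv.
have [z ez] : exists z, n = (z + p + d)%N by exists (n - p - d)%N; lia.
have -> : (n * n = n * z + n * (p + d))%N by rewrite {2}ez -mulnDr addnA.
have -> : (n - p - d = z)%N by lia.
have -> : (n + 2 * v - p - d = z + 2 * v)%N by lia.
rewrite [(n * (z + _))%N]mulnDr; move: h3; move: (n * z)%N (n * (p + d))%N (n * (2 * v))%N => a b c h3.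
by split; lia.
Qed.

(** * Points of an Artin-Schreier curve with prescribed trace *)

Section ArtinSchreier.

Variables (p : nat) (p_pr : prime p) (f : {poly 'F_p}).
Variables (K : closedFieldType) (iota : {rmorphism 'F_p -> K}).
Local Notation F := 'F_p.
Local Notation fK := (map_poly iota f).

Let p_gt0 : (0 < p)%N := prime_gt0 p_pr.

Lemma pcharK : p \in [pchar K].
Proof. by rewrite (rmorph_pchar iota) // pchar_Fp. Qed.

Definition frob : K -> K := pFrobenius_aut pcharK.

HB.instance Definition _ := GRing.RMorphism.on frob.

Lemma frobE x : frob x = x ^+ p.
Proof. by []. Qed.

Lemma frob_iota c : frob (iota c) = iota c.
Proof. by rewrite frobE -rmorphXn Fp_expp. Qed.

Lemma map_frob_iota (h : {poly F}) : map_poly frob (map_poly iota h) = map_poly iota h.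
Proof. by rewrite -map_poly_comp; apply: eq_map_poly => c /=; rewrite frob_iota. Qed.

Lemma horner_frob (h : {poly F}) (x : K) (n : nat) :
  (map_poly iota h).[x ^+ (p ^ n)] = (map_poly iota h).[x] ^+ (p ^ n).
Proof.
elim: n => [|n IH]; first by rewrite !expr1.
rewrite expnSr !exprM -IH -[LHS]/(_.[frob _]) -[RHS]/(frob _) -horner_map /=.
by rewrite map_frob_iota.
Qed.

Definition trace_sum (n : nat) (x : K) : K := \sum_(i < n) fK.[x ^+ (p ^ i)].

(** Raising y^p - y = f(x) to the power p^i gives y^(p^(i+1)) - y^(p^i) = f(x^(p^i)), and these
    differences telescope. *)
Lemma artin_schreier_expn (x y : K) (n : nat) :
  y ^+ p - y = fK.[x] -> y ^+ (p ^ n) = y + trace_sum n x.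
Proof.
move=> e; elim: n => [|n IH]; first by rewrite /trace_sum big_ord0 addr0 expr1.
rewrite expnSr exprM IH -[LHS]/(frob _) rmorphD /= /trace_sum big_ord_recl rmorph_sum /=.
rewrite expr1 -e addrA [y + _]addrC subrK; congr (_ + _); apply: eq_bigr => i _.
by rewrite frobE -(horner_frob f _ 1) expn1 -exprM -expnSr.
Qed.

(** The map y -> y^p - y is additive and kills F_p, so the translates of one root by F_p are all
    roots. *)
Lemma artin_schreier_roots (a : K) :
  exists ys, [/\ uniq ys, size ys = p & {in ys, forall y, y ^+ p - y = a}].
Proof.
have [y0 ry0] : exists y, root ('X^p - 'X - a%:P) y.
  apply/closed_rootP.
  have p1 := prime_gt1 p_pr.
  rewrite -addrA -opprD size_polyDl ?size_polyXn; last first.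
    by rewrite size_polyN size_XaddC.
  by case: p p_gt0.
exists [seq y0 + iota c | c : F]; split.
- by rewrite map_inj_uniq ?enum_uniq // => c c' /addrI /fmorph_inj.
- by rewrite size_map -cardE card_Fp.
- move=> y /imageP[c _ ->]; move: ry0; rewrite /root !hornerE => /eqP e.
  rewrite -[X in X - _]/(frob _) rmorphD /= frob_iota frobE opprD addrACA subrr addr0.
  by apply/eqP; rewrite -subr_eq0 e.
Qed.

(** By [artin_schreier_expn], x has trace c exactly when the p curve points above it satisfy y^(Q^2)
    = y + c with Q = p^s, which is the condition in [stepanov]. The expected size p^(2s-1) of a
    fibre is exceeded by at most 2 d p^s. *)
Lemma trace_count (d s : nat) (c : F) (rs : seq K) :
  (0 < d)%N -> size f = d.+1 -> ~~ (p %| d)%N ->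
  (p ^ 2 * d ^ 2 + 2 * d * p <= p ^ s)%N -> uniq rs ->
  {in rs, forall x, x ^+ (p ^ s.*2) = x /\ trace_sum s.*2 x = iota c} ->
  (p * size rs <= p ^ s.*2 + p ^ s * (2 * d * p))%N.
Proof.
move=> d0 sf pd hs urs hrs; have p1 := prime_gt1 p_pr.
case: s hs hrs => [|s] hs hrs.
  by move: hs; rewrite expn0; nia.
set P := (p ^ s)%N; have QP : (p ^ s.+1 = p * P)%N by rewrite expnS.
have QQ : (p ^ s.+1.*2 = p * P * (p * P))%N by rewrite -addnn expnD QP.
have dP : (p * d ^ 2 + 2 * d <= P)%N.
  by rewrite -(leq_pmul2l p_gt0) -QP; apply: leq_trans hs; nia.
(* I1 and I2 are near P = Q / p, the first lowered by d so that m1 < Q; I3 is the largest value that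
   the counting condition allows. *)
have := @stepanov p p_pr f d d0 sf K iota (p * P) (P - d) (P + d)
   ((P + d) * p * (P - d)).-1 c s.+1 rs (esym QP) pd.
have [P' eP] : exists P', P = (P' + d).+1.
  by exists (P - d).-1; move: dP; rewrite -!mulnn; nia.
have -> : (P - d).-1 = P' by rewrite eP; lia.
have -> : (P - d = P'.+1)%N by rewrite eP; lia.
have -> : (P + d).-1 = (P' + d + d)%N by rewrite eP; lia.
rewrite QQ QP.
have e1 : (p * P' + d * p.-1 = p * P - p - d)%N.
  have : (p * P' + d * p.-1 + p + d = p * P)%N.
    by rewrite eP; case: (p) p_gt0 => // q _ /=; ring.
  by move: (d * p.-1)%N (p * P)%N (p * P')%N; lia.
have e2 : (p * (P' + d + d) + d * p.-1 = p * P + 2 * d * p - p - d)%N.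
  have : (p * (P' + d + d) + d * p.-1 + p + d = p * P + 2 * d * p)%N.
    by rewrite eP; case: (p) p_gt0 => // q _ /=; ring.
  by move: (d * p.-1)%N (p * P)%N (p * _)%N (_ * p)%N; lia.
have hn : (p * p * (d * d) + 2 * (d * p) <= p * P)%N.
  by rewrite -QP; apply: leq_trans hs; rewrite -!mulnn; nia.
have [n1 n2 n3] := stepanov_parameters p1 d0 hn.
have e3 : (p * ((P + d) * p * P'.+1).-1 = p * P * (p * P) - p * p * (d * d) - p)%N.
  have -> : P'.+1 = (P - d)%N by rewrite eP; lia.
  have Pd : (d < P)%N by rewrite eP; lia.
  have [k ->] : exists k, P = (d + k.+1)%N by exists P'; rewrite eP; lia.
  rewrite addKn -subn1 mulnBr muln1; congr (_ - _)%N.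
  by rewrite -[LHS](addKn (p * p * (d * d))); congr (_ - _)%N; ring.
rewrite e1 e2 e3 => H.
apply: leq_trans (H _ _ _ urs _) _.
- exact: n1.
- exact: n2.
- rewrite prednK // !muln_gt0 p_gt0 /= andbT addn_gt0 d0 orbT //.
- move=> x /hrs [xq tx]; rewrite -QQ; split=> //.
  have [ys [uys sys hys]] := artin_schreier_roots fK.[x].
  exists ys; split=> // y /hys e; split=> //.
  by rewrite (artin_schreier_expn _ e) tx.
- exact: n3.
Qed.

End ArtinSchreier.

(** * Frobenius orbits and root multiplicities *)

Lemma perm_cat_of_uniq (T : eqType) (s t : seq T) :
  uniq s -> {subset s <= t} -> exists u, perm_eq t (s ++ u).
Proof.
elim: s t => [|x s IH] t /=; first by exists t.
case/andP => xs us st.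
have xt : x \in t by apply: st; rewrite inE eqxx.
have [|u pu] := IH (rem x t) us.
  move=> y ys; have := st y; rewrite inE ys orbT => /(_ isT).
  by rewrite (perm_mem (perm_to_rem xt)) inE => /predU1P[e|//]; rewrite -e ys in xs.
by exists u; rewrite (perm_trans (perm_to_rem xt)) // perm_cons.
Qed.

Section FrobeniusOrbits.

Variables (p : nat) (p_pr : prime p).
Variables (K : closedFieldType) (phi : {rmorphism 'F_p -> K}).
Local Notation F := 'F_p.
Local Notation frob := (frob p_pr phi).

Let p_gt0 : (0 < p)%N := prime_gt0 p_pr.

Lemma frob_inj : injective frob.
Proof. exact: fmorph_inj. Qed.

Lemma expp_inj n : injective (fun x : K => x ^+ (p ^ n)).
Proof.
elim: n => [|n IH] x y; first by rewrite /= !expr1.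
by rewrite /= expnSr !exprM => /frob_inj /IH.
Qed.

Definition orbit_seq (x : K) (j : nat) : seq K := mkseq (fun i => x ^+ (p ^ i)) j.

(* If x^(p^j) = x, this is a power of the minimal polynomial of x over F_p. *)
Definition orbit_poly (x : K) (j : nat) : {poly K} :=
  \prod_(y <- orbit_seq x j) ('X - y%:P).

Lemma orbit_polyD x k j : x ^+ (p ^ k) = x ->
  orbit_poly x (k + j) = orbit_poly x k * orbit_poly x j.
Proof.
move=> xk; rewrite /orbit_poly /orbit_seq /mkseq iotaD map_cat big_cat /= add0n.
congr (_ * _); rewrite -{1}[k]addn0 iotaDl -map_comp !big_map.
by apply: eq_bigr => i _ /=; rewrite expnD exprM xk.
Qed.

Lemma perm_frob_orbit x k : x ^+ (p ^ k.+1) = x ->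
  perm_eq [seq frob y | y <- orbit_seq x k.+1] (orbit_seq x k.+1).
Proof.
move=> xk; rewrite /orbit_seq /mkseq -map_comp.
have -> : [seq (frob \o (fun i => x ^+ (p ^ i))) i | i <- iota 0 k.+1]
   = [seq x ^+ (p ^ i) | i <- iota 1 k.+1].
  rewrite -[1%N]addn0 iotaDl -map_comp; apply: eq_map => i /=.
  by rewrite frobE -exprM -expnSr add1n.
have -> : iota 1 k.+1 = iota 1 k ++ [:: k.+1] by rewrite -[in LHS](addn1 k) iotaD add1n.
by rewrite map_cat /= xk expr1 perm_sym -cat1s perm_catC.
Qed.

Definition frob_stable (rs : seq K) := perm_eq [seq frob y | y <- rs] rs.

Lemma frob_stable_mem rs x i : frob_stable rs -> x \in rs -> x ^+ (p ^ i) \in rs.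
Proof.
move=> st xrs; elim: i => [|i IH]; first by rewrite expr1.
by rewrite expnSr exprM -[_ ^+ p]/(frob _) -(perm_mem st) map_f.
Qed.

(** One iterate more than there are entries forces a repetition, and injectivity of Frobenius
    removes the preperiod. *)
Lemma frob_period rs x : frob_stable rs -> x \in rs ->
  exists2 k, (k < size rs)%N & x ^+ (p ^ k.+1) = x.
Proof.
move=> st xrs.
have /(uniqPn 0) [i [j [ij jn]]] : ~~ uniq (orbit_seq x (size rs).+1).
  apply: contraPN (leqnn (size rs)) => /uniq_leq_size - /(_ rs).
  rewrite size_mkseq => h; apply/negP; rewrite -ltnNge; apply: h.
  by move=> y /mapP[i _ ->]; apply: frob_stable_mem.
rewrite size_mkseq in jn; rewrite !nth_mkseq ?(ltn_trans ij) // => e.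
exists (j - i).-1; first by lia.
rewrite prednK ?subn_gt0 //; apply: (@expp_inj i); rewrite /= -exprM -expnD.
by rewrite subnK ?(ltnW ij).
Qed.

(** The lengths j + 1 with x^(p^(j+1)) = x are the multiples e k' of the least period k', and the
    orbit polynomial is then the e-th power of the minimal polynomial. It divides the product
    exactly when e is at most the multiplicity of x. The induction removes one full orbit at a
    time. *)
Lemma count_orbit_poly (x : K) (rs : seq K) : frob_stable rs ->
  count_mem x rs = (\sum_(0 <= j < size rs)
    ((x ^+ (p ^ j.+1) == x)%R && (orbit_poly x j.+1 %| \prod_(y <- rs) ('X - y%:P))%R))%N.
Proof.
have [n] := ubnP (size rs); elim: n rs => // n IH rs; rewrite ltnS => srs st.
have xorb j : x \in orbit_seq x j.+1 by rewrite inE expr1 eqxx.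
have [xrs|xrs] := boolP (x \in rs); last first.
  rewrite (count_memPn xrs) big1 // => j _; apply/eqP; rewrite eqb0.
  apply: contra xrs => /andP[_ /dvdpP [q e]].
  by rewrite -root_prod_XsubC e rootM root_prod_XsubC xorb orbT.
have [k0 k0s xk0] := frob_period st xrs.
have ex : exists k, x ^+ (p ^ k.+1) == x by exists k0; apply/eqP.
case: (ex_minnP ex) => k /eqP xk kmin.
have kk0 : (k <= k0)%N by apply: kmin; apply/eqP.
have uorb : uniq (orbit_seq x k.+1).
  apply/negPn/negP => /(uniqPn 0) [i [j [ij]]]; rewrite size_mkseq => jk.
  rewrite !nth_mkseq ?(ltn_trans ij) // => e.
  have : (k <= (j - i).-1)%N.
    apply: kmin; rewrite prednK ?subn_gt0 //; apply/eqP; apply: (@expp_inj i).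
    by rewrite /= -exprM -expnD subnK ?(ltnW ij).
  by lia.
have [|u pu] := perm_cat_of_uniq uorb (t := rs).
  by move=> y /mapP[i _ ->]; apply: frob_stable_mem.
have su : size rs = (k.+1 + size u)%N by rewrite (perm_size pu) size_cat size_mkseq.
have stu : frob_stable u.
  have := perm_map frob pu; rewrite perm_sym => h.
  have := perm_trans (perm_trans h st) pu; rewrite map_cat => h'.
  have h2 : perm_eq (orbit_seq x k.+1 ++ [seq frob y | y <- u]) (orbit_seq x k.+1 ++ u).
    apply: perm_trans h'; rewrite perm_cat2r perm_sym; exact: perm_frob_orbit.
  by rewrite perm_cat2l in h2.
have eP : \prod_(y <- rs) ('X - y%:P) = orbit_poly x k.+1 * \prod_(y <- u) ('X - y%:P).
  by rewrite (perm_big _ pu) big_cat.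
have -> : count_mem x rs = (count_mem x u).+1.
  by rewrite (seq.permP pu) count_cat count_uniq_mem // xorb.
have sun : (size u < n)%N by apply: leq_trans srs; rewrite su addSn ltnS leq_addl.
rewrite (IH u sun stu); set Su := (\sum_(0 <= j < size u) _)%N.
(* Terms below k vanish by minimality of the period, the term at k counts the removed orbit, and the
   later ones, shifted by k + 1, form the sum for u. *)
have ku : (k <= k.+1 + size u)%N by lia.
rewrite su (big_cat_nat (leq0n k) ku) /=.
rewrite big1_seq ?add0n => [|j]; last first.
  rewrite mem_index_iota /= => jk; apply/eqP; rewrite eqb0.
  by apply/negP => /andP[/kmin]; rewrite leqNgt jk.
rewrite big_ltn; last by rewrite addSn ltnS leq_addr.
rewrite xk eqxx eP dvdp_mulr // add1n; congr _.+1.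
rewrite -[k.+1 in RHS]add0n big_addn add0n addKn; apply: eq_bigr => j _.
rewrite -addSn addnC expnD exprM xk orbit_polyD // dvdp_mul2l //.
by rewrite -size_poly_gt0 size_prod_XsubC.
Qed.

End FrobeniusOrbits.

(** * Monic polynomials over a finite field *)

Section MonicPolynomials.

Variable F : finFieldType.

Definition monic_seq (n : nat) : seq {poly F} :=
  [seq 'X^n + \sum_(i < n) v i *: 'X^i | v : {ffun 'I_n -> F}].

Lemma monic_poly_low n (v : {ffun 'I_n -> F}) :
  (size (\sum_(i < n) v i *: 'X^i)%R <= n)%N.
Proof.
rewrite (leq_trans (size_sum _ _ _)) //; apply/bigmax_leqP => i _.
by rewrite (leq_trans (size_scale_leq _ _)) // size_polyXn.
Qed.

Lemma monic_poly_coef n (v : {ffun 'I_n -> F}) (i : 'I_n) :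
  ('X^n + \sum_(i < n) v i *: 'X^i)`_i = v i.
Proof.
rewrite coefD coefXn ltn_eqF // add0r coef_sum (bigD1 i) //= big1.
  by rewrite coefZ coefXn eqxx mulr1 addr0.
by move=> j ji; rewrite coefZ coefXn val_eqE eq_sym (negbTE ji) mulr0.
Qed.

Lemma mem_monic_seq n (h : {poly F}) :
  (h \in monic_seq n) = (h \is monic) && (size h == n.+1).
Proof.
apply/mapP/andP => [[v _ ->]|[mh /eqP sh]].
  have s1 := monic_poly_low v.
  have sz : size ('X^n + \sum_(i < n) v i *: 'X^i) = n.+1.
    by rewrite size_polyDl size_polyXn.
  by rewrite monicE lead_coefDl ?size_polyXn // lead_coefXn sz !eqxx.
exists [ffun i : 'I_n => h`_i]; first by rewrite mem_enum.
apply/polyP => i; have [ni|ni] := ltnP i n.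
  by rewrite (monic_poly_coef _ (Ordinal ni)) ffunE.
rewrite coefD coefXn [X in _ + X]nth_default ?addr0; last first.
  by rewrite (leq_trans (monic_poly_low _)).
have [->|ne] := eqVneq i n; first by move: mh; rewrite monicE lead_coefE sh => /eqP.
by rewrite nth_default // sh ltn_neqAle eq_sym ne.
Qed.

Lemma monic_seq_uniq n : uniq (monic_seq n).
Proof.
rewrite map_inj_uniq ?enum_uniq // => v w e; apply/ffunP => i.
by rewrite -(monic_poly_coef v) e monic_poly_coef.
Qed.

Lemma perm_monic_seq_mul n (D : {poly F}) j : (j <= n)%N ->
  D \is monic -> size D = j.+1 ->
  perm_eq [seq h <- monic_seq n | D %| h] [seq D * h | h <- monic_seq (n - j)].
Proof.
move=> jn mD sD; have D0 : D != 0 by rewrite monic_neq0.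
apply: uniq_perm; first by rewrite filter_uniq ?monic_seq_uniq.
  by rewrite map_inj_uniq ?monic_seq_uniq // => h h' /(mulfI D0).
move=> h; rewrite mem_filter; apply/andP/mapP => [[/dvdpP [q eq]]|[q]].
  rewrite mem_monic_seq => /andP[mh /eqP sh].
  have mq : q \is monic by rewrite -(monicMr _ mD) -eq.
  exists q; last by rewrite mulrC.
  rewrite mem_monic_seq mq /=; move: sh; rewrite eq size_Mmonic ?monic_neq0 // sD.
  by rewrite addnS /=; move: (size q) => sq e; apply/eqP; lia.
rewrite mem_monic_seq => /andP[mq /eqP sq] ->; rewrite dvdp_mulr //.
rewrite mem_monic_seq monicMl // mq size_Mmonic // sD sq.
by split=> //; apply/eqP; lia.
Qed.

Lemma perm_monic_seq_add n (g : {poly F}) : (size g <= n)%N ->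
  perm_eq [seq h + g | h <- monic_seq n] (monic_seq n).
Proof.
move=> sg; have stab (g' h : {poly F}) : (size g' <= n)%N -> h \in monic_seq n -> h + g' \in monic_seq n.
  move=> sg'; rewrite !mem_monic_seq => /andP[mh /eqP sh].
  by rewrite monicE lead_coefDl ?size_polyDl ?sh //= -monicE mh eqxx.
apply: uniq_perm; rewrite ?monic_seq_uniq //.
  by rewrite map_inj_uniq ?monic_seq_uniq // => h h' /addIr.
move=> h; apply/mapP/idP => [[h' h'm ->]|hm]; first exact: stab.
by exists (h - g); rewrite ?subrK // stab ?size_polyN.
Qed.

End MonicPolynomials.

(** * The L-function of an additive character *)

Section LFunction.

Variables (p : nat) (p_pr : prime p) (f : {poly 'F_p}).
Variables (K : closedFieldType) (phi : {rmorphism 'F_p -> K}).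
Variables (C : comNzRingType) (psi : 'F_p -> C).
Hypotheses (psiD : {morph psi : x y / x + y >-> x * y}) (psi0 : psi 0 = 1).
Local Notation F := 'F_p.
Local Notation frob := (frob p_pr phi).
Local Notation fK := (map_poly phi f).

Let p_gt0 : (0 < p)%N := prime_gt0 p_pr.

(* The value 1 outside the image of [phi] is irrelevant. *)
Definition psiK (x : K) : C := if [pick c | phi c == x] is Some c then psi c else 1.

Lemma psiK_phi c : psiK (phi c) = psi c.
Proof.
rewrite /psiK; case: pickP => [c' /eqP /fmorph_inj -> //|/(_ c)].
by rewrite eqxx.
Qed.

Lemma frob_fixed x : frob x = x -> exists c, x = phi c.
Proof.
move=> xp; have p1 := prime_gt1 p_pr.
pose P : {poly K} := 'X^p - 'X.
have sP : size P = p.+1.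
  by rewrite size_polyDl ?size_polyXn // size_polyN size_polyX ltnS.
have [/imageP[c _ ->]|nx] := boolP (x \in [seq phi c | c : F]); first by exists c.
have : (size (x :: [seq phi c | c : F]) < size P)%N.
  apply: max_poly_roots; first by rewrite -size_poly_gt0 sP.
    apply/allP => y; rewrite inE => /predU1P[->|/imageP[c _ ->]].
      by rewrite /root /P !hornerE -[x ^+ p]/(frob x) xp subrr.
    by rewrite /root /P !hornerE -[_ ^+ p]/(frob _) frob_iota subrr.
  by rewrite /= nx map_inj_uniq ?enum_uniq //; apply: fmorph_inj.
by rewrite sP /= size_map -cardE card_Fp // ltnn.
Qed.

Lemma psiKD x y : frob x = x -> frob y = y -> psiK (x + y) = psiK x * psiK y.
Proof.
by move=> /frob_fixed[a ->] /frob_fixed[b ->]; rewrite -rmorphD !psiK_phi psiD.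
Qed.

Lemma horner_frob1 x : fK.[frob x] = frob fK.[x].
Proof. by rewrite -horner_map map_frob_iota. Qed.

Lemma frob_sum_stable rs : frob_stable p_pr phi rs ->
  frob (\sum_(x <- rs) fK.[x]) = \sum_(x <- rs) fK.[x].
Proof.
move=> st; rewrite rmorph_sum -[RHS](perm_big _ st) big_map.
by apply: eq_bigr => x _; rewrite horner_frob1.
Qed.

Definition proots (h : {poly F}) : seq K := sval (closed_field_poly_normal (map_poly phi h)).

Lemma proots_prod h : h \is monic ->
  map_poly phi h = \prod_(x <- proots h) ('X - x%:P).
Proof.
move=> mh; rewrite /proots; case: closed_field_poly_normal => rs /= ->.
by rewrite lead_coef_map (monicP mh) rmorph1 scale1r.
Qed.

Lemma size_proots h : h \is monic -> size (proots h) = (size h).-1.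
Proof.
move=> mh; have := size_map_poly phi h; rewrite proots_prod // size_prod_XsubC.
by move=> <-.
Qed.

Lemma frob_stable_prod rs :
  map_poly frob (\prod_(x <- rs) ('X - x%:P)) = \prod_(x <- rs) ('X - x%:P) ->
  frob_stable p_pr phi rs.
Proof.
move=> e; apply: prod_XsubC_eq; rewrite big_map -[RHS]e rmorph_prod.
by apply: eq_bigr => x _; rewrite rmorphB /= map_polyX map_polyC.
Qed.

Lemma proots_stable h : h \is monic -> frob_stable p_pr phi (proots h).
Proof.
by move=> mh; apply: frob_stable_prod; rewrite -proots_prod // map_frob_iota.
Qed.

(** The completely multiplicative function on monic polynomials whose series sum chi(h) T^(deg h) is
    the L-function. For monic h Frobenius permutes the roots, so the argument of [psiK] lies in
    F_p. *)
Definition chi (h : {poly F}) : C := psiK (\sum_(x <- proots h) fK.[x]).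

Lemma chiE h rs : h \is monic -> map_poly phi h = \prod_(x <- rs) ('X - x%:P) ->
  chi h = psiK (\sum_(x <- rs) fK.[x]).
Proof.
move=> mh e; rewrite /chi; congr psiK; apply: perm_big; apply: prod_XsubC_eq.
by rewrite -e -proots_prod.
Qed.

Lemma chiM h g : h \is monic -> g \is monic -> chi (h * g) = chi h * chi g.
Proof.
move=> mh mg; rewrite (@chiE _ (proots h ++ proots g)) ?monicMl //.
  by rewrite big_cat psiKD // frob_sum_stable // proots_stable.
by rewrite rmorphM /= !proots_prod // big_cat.
Qed.

Definition Lcoef (n : nat) : C := \sum_(h <- monic_seq F n) chi h.

Lemma Lcoef0 : Lcoef 0 = 1.
Proof.
have e : perm_eq (monic_seq F 0) [:: 1].
  apply: uniq_perm; rewrite ?monic_seq_uniq // => h.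
  rewrite mem_monic_seq inE; apply/andP/eqP => [[mh /size_poly1P [c _ e]]|->].
    by move: mh; rewrite e monicE lead_coefC => /eqP ->.
  by rewrite monic1 size_poly1.
rewrite /Lcoef (perm_big _ e) big_seq1 (@chiE _ [::]) ?monic1 ?big_nil ?rmorph1 //.
by rewrite -(rmorph0 phi) psiK_phi.
Qed.

(** The field of p^j elements inside K. For j = 0 the polynomial is zero and the list has no such
    meaning, whence the conditions 0 < j below. *)
Definition fixed_points (j : nat) : seq K :=
  undup (sval (closed_field_poly_normal ('X^(p ^ j) - 'X : {poly K}))).

Lemma mem_fixed_points j x : (0 < j)%N ->
  (x \in fixed_points j) = (x ^+ (p ^ j) == x).
Proof.
move=> j0; have p1 := prime_gt1 p_pr.
rewrite mem_undup; case: closed_field_poly_normal => rs /= e.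
have sP : size ('X^(p ^ j) - 'X : {poly K}) = (p ^ j).+1.
  rewrite size_polyDl ?size_polyXn // size_polyN size_polyX ltnS.
  by have : (p ^ 0 < p ^ j)%N by rewrite ltn_exp2l.
rewrite -root_prod_XsubC -(@rootZ _ _ (lead_coef ('X^(p ^ j) - 'X))) -?e; last first.
  by rewrite lead_coef_eq0 -size_poly_gt0 sP.
by rewrite /root !hornerE subr_eq0.
Qed.

Definition char_sum (j : nat) : C :=
  \sum_(x <- fixed_points j) psiK (trace_sum f phi j x).

(** Frobenius permutes the orbit, so it fixes the coefficients, which therefore lie in F_p. *)
Lemma orbit_poly_descent x j : x ^+ (p ^ j) = x ->
  exists2 D : {poly F}, D \is monic & map_poly phi D = orbit_poly p x j.
Proof.
move=> xj; pose P := orbit_poly p x j.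
have st : frob_stable p_pr phi (orbit_seq p x j).
  by case: j xj {P} => [|j] xj //; apply: perm_frob_orbit.
have eP : map_poly frob P = P.
  rewrite /P /orbit_poly rmorph_prod -[RHS](perm_big _ st) [RHS]big_map.
  by apply: eq_bigr => y _; rewrite rmorphB /= map_polyX map_polyC.
have cP i : {c | phi c == P`_i}.
  apply: sigW; have [|c e] := @frob_fixed P`_i; last by exists c; rewrite e.
  by rewrite -{2}eP coef_map.
pose D : {poly F} := \poly_(i < size P) sval (cP i).
have eD : map_poly phi D = P.
  apply/polyP => i; rewrite coef_map coef_poly; case: ltnP => iP.
    by apply/eqP; apply: (svalP (cP i)).
  by rewrite [RHS]nth_default //; apply: (rmorph0 phi).
exists D => //; rewrite monicE -(inj_eq (fmorph_inj phi)) rmorph1 -lead_coef_map eD.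
by rewrite -monicE monic_prod_XsubC.
Qed.

(** The multiples of the orbit polynomial D are the products D g with g monic of degree n - j, and
    chi(D) is psi of the trace because the roots of D are the conjugates of x. *)
Lemma sum_chi_orbit n x j : (0 < j <= n)%N -> x ^+ (p ^ j) = x ->
  \sum_(h <- monic_seq F n | orbit_poly p x j %| map_poly phi h) chi h =
  psiK (trace_sum f phi j x) * Lcoef (n - j).
Proof.
case/andP => j0 jn xj; have [D mD eD] := orbit_poly_descent xj.
have sD : size D = j.+1.
  by rewrite -(size_map_poly phi) eD size_prod_XsubC size_mkseq.
rewrite -eD; under eq_bigl do rewrite dvdp_map.
rewrite -big_filter (perm_big _ (perm_monic_seq_mul jn mD sD)) big_map.
rewrite /Lcoef mulr_sumr big_seq [RHS]big_seq; apply: eq_bigr => h.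
rewrite mem_monic_seq => /andP[mh _]; rewrite chiM //; congr (_ * _).
by rewrite (@chiE _ (orbit_seq p x j)) // big_map /trace_sum
   -(big_mkord xpredT (fun i => fK.[x ^+ (p ^ i)])) /index_iota subn0.
Qed.

(* The logarithmic derivative of the Euler product of the L-function. *)
Lemma Lcoef_rec n :
  n%:R * Lcoef n = \sum_(0 <= j < n) char_sum j.+1 * Lcoef (n - j.+1).
Proof.
(* A range of summation common to all h: it contains every root of every monic polynomial of degree
   n. *)
pose A := undup (flatten [seq fixed_points j.+1 | j <- iota 0 n]).
have memA j x : (j < n)%N -> x ^+ (p ^ j.+1) = x -> x \in A.
  move=> jn e; rewrite mem_undup; apply/flatten_mapP; exists j; first by rewrite mem_iota.
  by rewrite mem_fixed_points // e.
pose B (j : nat) (x : K) (h : {poly F}) :=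
  (x ^+ (p ^ j.+1) == x) && (orbit_poly p x j.+1 %| map_poly phi h).
(* The degree n is the number of roots with multiplicity, and [count_orbit_poly] expands each
   multiplicity. *)
have cnt h : h \in monic_seq F n ->
    n%:R = \sum_(x <- A) \sum_(0 <= j < n) (B j x h)%:R :> C.
  rewrite mem_monic_seq => /andP[mh /eqP sh].
  have szr : size (proots h) = n by rewrite size_proots // sh.
  have cE x : count_mem x (proots h) = (\sum_(0 <= j < n) B j x h)%N.
    by rewrite (count_orbit_poly x (proots_stable mh)) szr -proots_prod.
  under eq_bigr do rewrite -natr_sum -cE.
  rewrite -natr_sum; congr _%:R; rewrite -{1}szr -sum1_size.
  under [RHS]eq_bigr do rewrite -sum1_count big_mkcond.
  rewrite exchange_big /= big_seq_cond [RHS]big_seq_cond; apply: eq_bigr => y /andP[yh _].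
  have yA : y \in A.
    have [k k1 yk] := frob_period (proots_stable mh) yh.
    by apply: (memA k) => //; rewrite -szr.
  rewrite (bigD1_seq y) ?undup_uniq //= eqxx big1 // => x xy.
  by rewrite eq_sym (negbTE xy).
rewrite /Lcoef mulr_sumr.
transitivity (\sum_(h <- monic_seq F n) \sum_(x <- A) \sum_(0 <= j < n) (B j x h)%:R * chi h).
  rewrite big_seq [RHS]big_seq; apply: eq_bigr => h hm; rewrite (cnt h hm) mulr_suml.
  by apply: eq_bigr => x _; rewrite mulr_suml.
under eq_bigr do rewrite exchange_big.
rewrite exchange_big big_nat [RHS]big_nat; apply: eq_bigr => j /andP[_ jn].
rewrite exchange_big /= /char_sum mulr_suml.
transitivity (\sum_(x <- A | x ^+ (p ^ j.+1) == x)
   psiK (trace_sum f phi j.+1 x) * Lcoef (n - j.+1)).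
  rewrite [RHS]big_mkcond; apply: eq_bigr => x _.
  case: eqP => xj; last first.
    by rewrite big1 // => h _; rewrite /B; case: eqP xj => // _ _; rewrite mul0r.
  rewrite -sum_chi_orbit // [RHS]big_mkcond; apply: eq_bigr => h _.
  by rewrite /B xj eqxx /=; case: ifP; rewrite ?mul1r ?mul0r.
rewrite -[LHS]big_filter; apply: perm_big; apply: uniq_perm.
- by rewrite filter_uniq ?undup_uniq.
- by rewrite undup_uniq.
- move=> x; rewrite mem_filter mem_fixed_points //; case: eqP => //= xj.
  by rewrite (memA j).
Qed.

End LFunction.

(** Among the first d elementary symmetric functions only the d-th one changes. By Newton's
    identities the power sums below d stay the same, and the d-th one moves by a multiple of t. *)
Lemma power_sum_shift (A : comNzRingType) (rs rs' : seq A) (n d : nat) (t : A) :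
  size rs = n -> size rs' = n -> (0 < d <= n)%N ->
  \prod_(x <- rs') ('X - x%:P) = \prod_(x <- rs) ('X - x%:P) + t *: 'X^(n - d) ->
  forall j, (0 < j <= d)%N ->
  \sum_(x <- rs') x ^+ j = \sum_(x <- rs) x ^+ j - (if j == d then t *+ d else 0).
Proof.
move=> srs srs' /andP[d0 dn] e.
pose L := \prod_(r <- rs) (1 - r *: 'X); pose L' := \prod_(r <- rs') (1 - r *: 'X).
have LE j : (j <= d)%N -> L'`_j = L`_j + (if j == d then t else 0).
  move=> jd; have jn := leq_trans jd dn.
  rewrite /L' /L -!prod_XsubC_coef_rev ?srs ?srs' // e coefD coefZ coefXn.
  congr (_ + _); have -> : (n - j == n - d)%N = (j == d) by lia.
  by case: eqP; rewrite ?mulr1 ?mulr0.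
have L0 : L`_0 = 1.
  rewrite /L -prod_XsubC_coef_rev // subn0.
  by have /monicP := monic_prod_XsubC rs xpredT id; rewrite lead_coefE size_prod_XsubC.
have L'0 : L'`_0 = 1 by rewrite LE // L0 -[0%N == d]/(0 == d) (ltn_eqF d0) addr0.
move=> j; have [m] := ubnP j; elim: m j => // m IH [|j] // jm /andP[_ jd].
have := newton_prod rs' j.+1; have := newton_prod rs j.+1.
rewrite -/L -/L' !big_ord_recr /= !subnn L0 L'0 !mulr1 (LE j.+1) // mulrnDl => e1.
rewrite e1.
have -> : \sum_(i < j) (\sum_(r <- rs') r ^+ i.+1) * L'`_(j.+1 - i.+1) =
          \sum_(i < j) (\sum_(r <- rs) r ^+ i.+1) * L`_(j.+1 - i.+1).
  apply: eq_bigr => i _; have ij := ltn_ord i.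
  rewrite IH ?LE; try lia.
  have -> : (i.+1 == d) = false by lia.
  have -> : (j.+1 - i.+1 == d)%N = false by lia.
  by rewrite subr0 addr0.
rewrite !opprD -addrA => /addrI e2.
apply: oppr_inj; rewrite -e2 opprB addrC; congr (_ - _).
have [->|_] := eqVneq j.+1 d; first by [].
by rewrite mul0rn.
Qed.

(** * Growth of power sums *)

Section Growth.
Variable R : realType.

Lemma normC_normc (x : R[i]) : `|x| = (normc x)%:C%C.
Proof. by []. Qed.

Lemma normc_ge0 (x : R[i]) : 0 <= normc x.
Proof. by rewrite -lecR; exact: (normr_ge0 x). Qed.

Lemma normc_eq0 (x : R[i]) : (normc x == 0) = (x == 0).
Proof. by apply/eqP/eqP => [/eq0_normc //|->]; rewrite normc0. Qed.

Lemma normcX (x : R[i]) n : normc (x ^+ n) = normc x ^+ n.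
Proof. by elim: n => [|n IH]; rewrite ?normc1 // !exprS normcM IH. Qed.

Lemma ler_normc_sum (I : Type) (r : seq I) (P : pred I) (G : I -> R[i]) :
  normc (\sum_(i <- r | P i) G i) <= \sum_(i <- r | P i) normc (G i).
Proof.
elim/big_rec2: _ => [|i y x _ h]; first by rewrite normc0.
by apply: le_trans (le_normcD _ _) _; rewrite lerD2l.
Qed.

(** If x > B, then (x / B)^r >= 1 + r (x / B - 1) exceeds c for large r. *)
Lemma exp_growth_le (x B c : R) (r0 : nat) : 0 < B -> 0 <= x ->
  (forall r, (r0 <= r)%N -> x ^+ r <= c * B ^+ r) -> x <= B.
Proof.
move=> B0 x0 h; rewrite leNgt; apply/negP => Bx.
pose y := x / B; have y1 : 1 < y by rewrite ltr_pdivlMr // mul1r.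
have hy r : (r0 <= r)%N -> y ^+ r <= c.
  by move=> /h; rewrite /y expr_div_n ler_pdivrMr // exprn_gt0.
have bern r : 1 + r%:R * (y - 1) <= y ^+ r.
  by rewrite -[y in X in _ <= X](subrKC 1) bernoulli_ineq // subr_ge0 ltW.
pose r := maxn r0 (Num.truncn (c / (y - 1))).+1.
have := hy r (leq_maxl _ _); apply/negP; rewrite -ltNge.
apply: lt_le_trans (bern r); rewrite ltr_wpDl // -ltr_pdivrMr ?subr_gt0 //.
apply: lt_le_trans (truncnS_gt _) _; by rewrite ler_nat leq_maxr.
Qed.

Lemma power_sum_growth (zs : seq R[i]) (B c : R) (r0 : nat) : 0 < B ->
  (forall r, (r0 <= r)%N -> normc (\sum_(z <- zs) z ^+ r) <= c * B ^+ r) ->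
  {in zs, forall z, normc z <= B}.
Proof.
move=> B0 h z zzs.
(* Applying the recurrence operator P to the power sums isolates the powers of z. *)
pose P : {poly R[i]} := \prod_(w <- undup (filter (predC1 z) zs)) ('X - w%:P).
have Pz0 : P.[z] != 0.
  rewrite -[_ == 0]/(root P z) root_prod_XsubC mem_undup mem_filter /= eqxx.
  by [].
have Pw w : w \in zs -> w != z -> P.[w] = 0.
  move=> wzs wz; apply/eqP; rewrite -[_ == 0]/(root P w) root_prod_XsubC.
  by rewrite mem_undup mem_filter /= wz.
pose m := count_mem z zs.
have m0 : (0 < m)%N by rewrite -has_count has_pred1.
have key r : \sum_(k < size P) P`_k * \sum_(w <- zs) w ^+ (r + k) = (P.[z] *+ m) * z ^+ r.
  under eq_bigr do rewrite mulr_sumr; rewrite exchange_big /=.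
  transitivity (\sum_(w <- zs | w == z) P.[z] * z ^+ r).
    rewrite [RHS]big_mkcond big_seq [RHS]big_seq; apply: eq_bigr => w wzs.
    have -> : \sum_(k < size P) P`_k * w ^+ (r + k) = P.[w] * w ^+ r.
      rewrite horner_coef mulr_suml; apply: eq_bigr => k _.
      by rewrite exprD mulrCA mulrC -mulrA [w ^+ k * _]mulrC mulrA mulrAC.
    by case: eqVneq => [->//|/Pw -> //]; rewrite mul0r.
  by rewrite big_const_seq iter_addr_0 -/m mulrnAl.
(* Non-zero: P does not vanish at z, and the multiplicity m is invertible in characteristic 0. *)
pose D := normc (P.[z] *+ m).
have D0 : 0 < D.
  by rewrite lt_neqAle normc_ge0 andbT eq_sym normc_eq0 mulrn_eq0 negb_or Pz0 -lt0n m0.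
apply: (@exp_growth_le _ _ ((\sum_(k < size P) normc P`_k * (c * B ^+ k)) / D) r0) => //.
  exact: normc_ge0.
move=> r rr0; rewrite mulrAC ler_pdivlMr // mulrC -normcX /D -normcM -key.
apply: le_trans (ler_normc_sum _ _ _) _; rewrite mulr_suml; apply: ler_sum => k _.
rewrite normcM -mulrA ler_wpM2l ?normc_ge0 //.
apply: le_trans (h _ _) _; first by rewrite (leq_trans rr0) ?leq_addr.
by rewrite exprD [B ^+ r * _]mulrC mulrA.
Qed.
End Growth.

(** * Weil's bound for additive character sums *)

Section Weil.

Variables (R : realType) (p : nat) (p_pr : prime p) (f : {poly 'F_p}) (d : nat).
Hypotheses (d_gt0 : (0 < d)%N) (size_f : size f = d.+1) (pd : ~~ (p %| d)%N).
Variables (K : closedFieldType) (phi : {rmorphism 'F_p -> K}).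
Variables (psi : 'F_p -> R[i]).
Hypotheses (psiD : {morph psi : x y / x + y >-> x * y}) (psi0 : psi 0 = 1).
Hypotheses (psi_norm : forall x, normc (psi x) = 1) (psi_nontriv : exists b, psi b != 1).
Local Notation F := 'F_p.
Local Notation fK := (map_poly phi f).
Local Notation chi := (chi f phi psi).
Local Notation Lcoef := (Lcoef f phi psi).
Local Notation char_sum := (char_sum f phi psi).

Let p_gt0 : (0 < p)%N := prime_gt0 p_pr.

(* Among the power sums of degree at most d, only the d-th one depends on the
   coefficient of degree n - d, and it does so affinely. *)
Lemma chi_add (n : nat) (h : {poly F}) (t : F) : (d <= n)%N -> h \in monic_seq F n ->
  chi (h + t *: 'X^(n - d)) = psi (- (lead_coef f * t *+ d)) * chi h.
Proof.
move=> dn; rewrite mem_monic_seq => /andP[mh /eqP sh].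
pose h' := h + t *: 'X^(n - d).
have sX : (size (t *: 'X^(n - d) : {poly F})%R < size h)%N.
  by rewrite sh ltnS (leq_trans (size_scale_leq _ _)) // size_polyXn; lia.
have mh' : h' \is monic by rewrite monicE lead_coefDl // -monicE.
have sh' : size h' = n.+1 by rewrite size_polyDl.
have e : \prod_(x <- proots phi h') ('X - x%:P) =
         \prod_(x <- proots phi h) ('X - x%:P) + phi t *: 'X^(n - d).
  by rewrite -!proots_prod // rmorphD /= map_polyZ map_polyXn.
have szr : size (proots phi h) = n by rewrite size_proots // sh.
have szr' : size (proots phi h') = n by rewrite size_proots // sh'.
have dn' : (0 < d <= n)%N by rewrite d_gt0.
have ps := power_sum_shift szr szr' dn' e.
have hE rs : size rs = n -> \sum_(x <- rs) fK.[x] =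
    phi f`_0 *+ n + \sum_(1 <= i < d.+1) phi f`_i * \sum_(x <- rs) x ^+ i.
  move=> srs; transitivity (\sum_(0 <= i < d.+1) phi f`_i * \sum_(x <- rs) x ^+ i).
    under [RHS]eq_bigr do rewrite mulr_sumr.
    rewrite exchange_big /=; apply: eq_bigr => x _.
    by rewrite horner_coef size_map_poly size_f big_mkord; apply: eq_bigr => i _; rewrite coef_map.
  rewrite big_ltn //; congr (_ + _).
  under eq_bigr do rewrite expr0.
  by rewrite big_const_seq count_predT srs iter_addr_0 mulr_natr.
have key : \sum_(x <- proots phi h') fK.[x] =
    phi (- (lead_coef f * t *+ d)) + \sum_(x <- proots phi h) fK.[x].
  rewrite !hE // addrCA; congr (_ + _).
  rewrite !(big_nat_recr d) //= (ps d) ?d_gt0 ?leqnn // eqxx.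
  have -> : \sum_(1 <= i < d) phi f`_i * \sum_(x <- proots phi h') x ^+ i =
            \sum_(1 <= i < d) phi f`_i * \sum_(x <- proots phi h) x ^+ i.
    rewrite big_nat [RHS]big_nat; apply: eq_bigr => i /andP[i0 id].
    have i0d : (0 < i <= d)%N by rewrite i0 (ltnW id).
    by rewrite (ps i i0d) (ltn_eqF id) subr0.
  rewrite lead_coefE size_f rmorphN rmorphMn rmorphM mulrBr -mulrnAr addrCA; congr (_ + _).
  by rewrite addrC.
rewrite /chi /= -/h' key psiKD ?psiK_phi //; first exact: frob_iota.
by apply: frob_sum_stable; apply: proots_stable.
Qed.

(** Adding t X^(n-d) permutes the monic polynomials of degree n and, for the right t, multiplies chi
    by psi(b) with psi(b) different from 1. Solving for t requires that p does not divide d. *)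
Lemma Lcoef_vanish n : (d <= n)%N -> Lcoef n = 0.
Proof.
move=> dn; have [b hb] := psi_nontriv.
have lf0 : lead_coef f *+ d != 0.
  rewrite -mulr_natr mulf_neq0 //; first by rewrite lead_coef_eq0 -size_poly_eq0 size_f.
  by rewrite -(dvdn_pcharf (pchar_Fp p_pr)).
pose t := - b / (lead_coef f *+ d).
have pe : perm_eq [seq h + t *: 'X^(n - d) | h <- monic_seq F n] (monic_seq F n).
  apply: perm_monic_seq_add.
  by rewrite (leq_trans (size_scale_leq _ _)) // size_polyXn; lia.
have : Lcoef n = psi b * Lcoef n.
  rewrite {1}/Lcoef -(perm_big _ pe) big_map mulr_sumr big_seq [RHS]big_seq.
  apply: eq_bigr => h hm; rewrite chi_add //; congr (psi _ * _).
  by rewrite -mulrnAl /t mulrCA mulfV // mulr1 opprK.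
move/eqP; rewrite -subr_eq0 -{1}[Lcoef n]mul1r -mulrBl mulf_eq0 subr_eq0 eq_sym (negbTE hb).
by move/eqP.
Qed.

Lemma size_fixed_points j : (0 < j)%N -> size (fixed_points p K j) = (p ^ j)%N.
Proof.
move=> j0; have p1 := prime_gt1 p_pr.
rewrite /fixed_points; case: closed_field_poly_normal => rs /=.
set P : {poly K} := 'X^(p ^ j) - 'X => e.
have sP : size P = (p ^ j).+1.
  rewrite size_polyDl ?size_polyXn // size_polyN size_polyX ltnS.
  by have : (p ^ 0 < p ^ j)%N by rewrite ltn_exp2l.
have lP : lead_coef P != 0 by rewrite lead_coef_eq0 -size_poly_gt0 sP.
have sepP : separable_poly P.
  rewrite unlock derivB derivXn derivX.
  rewrite -mulr_natr -polyC_natr natrX (_ : p%:R = 0); last first.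
    by have /andP[_ /eqP] := pcharK p_pr phi.
  rewrite expr0n -[j == 0%N]negbK -lt0n j0 mulr0 sub0r -scaleN1r coprimepZr ?coprimep1 //.
  by rewrite oppr_eq0 oner_eq0.
have urs : uniq rs by rewrite -separable_prod_XsubC -(eqp_separable (eqp_scale _ lP)) -e.
by rewrite undup_id //; apply: succn_inj; rewrite -sP e size_scale // size_prod_XsubC.
Qed.

Lemma sum_psi : \sum_c psi c = 0.
Proof.
have [b hb] := psi_nontriv.
have : \sum_c psi c = psi b * \sum_c psi c.
  rewrite mulr_sumr (reindex_inj (addrI b)) /=.
  by apply: eq_bigr => c _; rewrite psiD.
move/eqP; rewrite -subr_eq0 -{1}[\sum_c _]mul1r -mulrBl mulf_eq0 subr_eq0 eq_sym (negbTE hb).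
by move/eqP.
Qed.

Lemma trace_sum_fixed j x : x ^+ (p ^ j) = x ->
  frob p_pr phi (trace_sum f phi j x) = trace_sum f phi j x.
Proof.
move=> xj; have -> : trace_sum f phi j x = \sum_(y <- orbit_seq p x j) fK.[y].
  rewrite big_map /trace_sum.
  by rewrite -(big_mkord xpredT (fun i => fK.[x ^+ (p ^ i)])) /index_iota subn0.
apply: frob_sum_stable; case: j xj => [|j] xj; first exact: perm_refl.
exact: perm_frob_orbit.
Qed.

Lemma char_sum_bound s : (p ^ 2 * d ^ 2 + 2 * d * p <= p ^ s)%N ->
  normc (char_sum s.*2) <= (2 * d * p)%:R * p%:R ^+ s.
Proof.
move=> hs; have s0 : (0 < s)%N by case: s hs => //; rewrite expn0; have := prime_gt1 p_pr; nia.
have s20 : (0 < s.*2)%N by rewrite double_gt0.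
pose fp := fixed_points p K s.*2.
pose N (c : F) := size [seq x <- fp | trace_sum f phi s.*2 x == phi c].
pose B := (p ^ s.*2 + p ^ s * (2 * d * p))%N.
have hN c : (p * N c <= B)%N.
  apply: (@trace_count p p_pr f K phi d s c) => //; first by rewrite filter_uniq ?undup_uniq.
  by move=> x; rewrite mem_filter mem_fixed_points // => /andP[/eqP ? /eqP ?].
have fib (A : nmodType) (G : K -> A) :
    \sum_(x <- fp) G x = \sum_c \sum_(x <- fp | trace_sum f phi s.*2 x == phi c) G x.
  under [RHS]eq_bigr do rewrite big_mkcond.
  rewrite exchange_big big_seq [RHS]big_seq; apply: eq_bigr => x.
  rewrite mem_fixed_points // => /eqP xf.
  have [c ec] := frob_fixed (trace_sum_fixed xf).
  rewrite (bigD1 c) //= ec eqxx big1 ?addr0 // => c' cc'.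
  by rewrite (inj_eq (fmorph_inj phi)) eq_sym (negbTE cc').
have sumN : (\sum_c N c = p ^ s.*2)%N.
  rewrite -(size_fixed_points s20) -/fp -sum1_size; apply/esym.
  rewrite (fib _ (fun=> 1%N)); apply: eq_bigr => c _.
  by rewrite sum1_count /N size_filter.
have SE : char_sum s.*2 = \sum_c psi c *+ N c.
  rewrite /char_sum (fib _ (fun x => psiK phi psi (trace_sum f phi s.*2 x))).
  apply: eq_bigr => c _; under eq_bigr => x /eqP -> do rewrite psiK_phi.
  by rewrite big_const_seq iter_addr_0 /N size_filter.
(* As the values of psi sum to 0, each p N(c) may be replaced by its non-negative shortfall B - p
   N(c); the shortfalls sum to p B - p p^(2s) = 2 d p^2 p^s. *)
have pS : char_sum s.*2 *+ p = - \sum_c psi c *+ (B - p * N c).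
  rewrite SE -sumrMnl -sumrN; apply/eqP; rewrite -subr_eq0 -sumrB; apply/eqP.
  transitivity (\sum_c psi c *+ B); last by rewrite sumrMnl sum_psi mul0rn.
  apply: eq_bigr => c _; rewrite opprK -mulrnA -mulrnDr; congr (_ *+ _).
  by rewrite mulnC subnKC.
have p0 : 0 < p%:R :> R by rewrite ltr0n.
rewrite -(ler_pM2r p0) !mulr_natr -normcMn pS normcN.
apply: le_trans (ler_normc_sum _ _ _) _.
under eq_bigr do rewrite normcMn psi_norm.
rewrite -natr_sum sumnB // sum_nat_const card_Fp // -big_distrr /= sumN /B mulnDr addKn.
by rewrite -natrX -natrM -mulrnA ler_nat leq_eqVlt; apply/orP; left; apply/eqP; ring.
Qed.

Lemma weil_closed : normc (\sum_(x : F) psi f.[x]) <= d.-1%:R * Num.sqrt p%:R.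
Proof.
(* The reversed L-function: its roots are the inverse roots omega_i, and it is monic because
   [Lcoef 0] is 1. *)
pose Q : {poly R[i]} := \poly_(i < d) Lcoef (d.-1 - i).
have L0 := Lcoef0 f phi psi0.
have sQ : size Q = d.
  rewrite -(prednK d_gt0) /Q -{1}(prednK d_gt0) size_poly_eq // subnn L0.
  exact: oner_neq0.
have Qm : Q \is monic.
  by rewrite monicE lead_coefE sQ /Q coef_poly prednK // leqnn subnn L0.
have [zs] := closed_field_poly_normal Q; rewrite (monicP Qm) scale1r => eQ.
have szs : size zs = d.-1 by rewrite -sQ eQ size_prod_XsubC.
have LE j : (\prod_(z <- zs) (1 - z *: 'X))`_j = Lcoef j.
  have [jd|dj] := ltnP j d.
    have jd1 : (j <= d.-1)%N by rewrite -ltnS prednK.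
    have jz : (j <= size zs)%N by rewrite szs.
    rewrite -(prod_XsubC_coef_rev jz) -eQ coef_poly szs subKn //.
    by rewrite (_ : (d.-1 - j < d)%N) // -[X in (_ < X)%N](prednK d_gt0) ltnS leq_subr.
  rewrite Lcoef_vanish // nth_default // (leq_trans _ dj) //.
  by rewrite (leq_trans (size_prod_1subZX _)) // szs prednK.
(* Newton's identities for [zs] and [Lcoef_rec] are the same recurrence up to sign, and both
   determine the next term. *)
have SP j : char_sum j.+1 = - \sum_(z <- zs) z ^+ j.+1.
  have [n] := ubnP j; elim: n j => // n IH j; rewrite ltnS => jn.
  have := newton_prod zs j.+1; rewrite LE -mulr_natl Lcoef_rec //.
  rewrite big_mkord !big_ord_recr /= !subnn !LE L0 !mulr1 opprD.
  have -> : - (\sum_(i < j) (\sum_(z <- zs) z ^+ i.+1) *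
       (\prod_(z <- zs) (1 - z *: 'X))`_(j.+1 - i.+1)) =
      \sum_(i < j) char_sum i.+1 * Lcoef (j.+1 - i.+1).
    rewrite -sumrN; apply: eq_bigr => i _.
    by rewrite LE IH ?mulNr // (leq_trans (ltn_ord i)).
  by move/addrI.
have p0 : 0 < p%:R :> R by rewrite ltr0n.
(* Only even extension degrees are bounded, so the growth lemma is applied to the squares w^2. Its
   threshold works because r < p^r. *)
have zB z : z \in zs -> normc z <= Num.sqrt p%:R.
  move=> zzs; rewrite -(ger0_norm (normc_ge0 z)) -sqrtr_sqr ler_sqrt // -normcX.
  apply: (@power_sum_growth R [seq w ^+ 2 | w <- zs] p%:R (2 * d * p)%:R
      (p ^ 2 * d ^ 2 + 2 * d * p)) => //; last exact: map_f.
  move=> r hr; rewrite big_map.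
  have r0 : (0 < r)%N by apply: leq_trans hr; rewrite addn_gt0 !muln_gt0 d_gt0 p_gt0 orbT.
  have -> : \sum_(w <- zs) (w ^+ 2) ^+ r = - char_sum r.*2.
    rewrite -(prednK (_ : 0 < r.*2)%N) ?double_gt0 // SP opprK prednK ?double_gt0 //.
    by apply: eq_bigr => w _; rewrite -exprM mul2n.
  rewrite normcN; apply: char_sum_bound; apply: leq_trans hr (ltnW (ltn_expl _ _)).
  exact: prime_gt1.
have -> : \sum_(x : F) psi f.[x] = char_sum 1.
  have pe : perm_eq (fixed_points p K 1) [seq phi c | c : F].
    apply: uniq_perm; first exact: undup_uniq.
      by rewrite map_inj_uniq ?enum_uniq //; apply: fmorph_inj.
    move=> x; rewrite mem_fixed_points // expn1; apply/eqP/imageP => [|[c _ ->]].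
      by move=> /(@frob_fixed _ p_pr _ phi) [c ->]; exists c.
    exact: (frob_iota p_pr phi c).
  rewrite /char_sum (perm_big _ pe) big_image /=; apply: eq_bigr => c _.
  by rewrite /trace_sum big_ord1 expn0 expr1 horner_map psiK_phi.
rewrite SP normcN; apply: le_trans (ler_normc_sum _ _ _) _.
have -> : d.-1%:R * Num.sqrt p%:R = \sum_(z <- zs) Num.sqrt p%:R :> R.
  by rewrite big_const_seq count_predT iter_addr_0 mulr_natl szs.
rewrite big_seq [X in _ <= X]big_seq; apply: ler_sum => z zzs.
by rewrite expr1 zB.
Qed.

End Weil.

Theorem weil_bound (R : realType) (p : nat) (f : {poly 'F_p}) (d : nat)
    (psi : 'F_p -> R[i]) :
  prime p -> (0 < d)%N -> size f = d.+1 -> ~~ (p %| d)%N ->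
  {morph psi : x y / x + y >-> x * y} -> psi 0 = 1 ->
  (forall x, normc (psi x) = 1) -> (exists b, psi b != 1) ->
  normc (\sum_(x : 'F_p) psi f.[x]) <= d.-1%:R * Num.sqrt p%:R.
Proof.
move=> p_pr d0 sf pd psiD psi0 psiN psi1.
have [K [phi _]] := countable_algebraic_closure 'F_p.
exact: (weil_closed p_pr d0 sf pd phi).
Qed.

(** * The divisor bound and a sieve *)

Lemma size_divisors (n : nat) :
  size (divisors n) = (\prod_(q <- primes n) (logn q n).+1)%N.
Proof.
rewrite /divisors prime_decompE; elim: (primes n) => [|q s IH]; first by rewrite big_nil.
rewrite big_cons /= -IH /PrimeDecompAux.add_divisors; set ds := foldr _ _ _.
elim: (logn q n) => [|e IHe]; first by rewrite mul1n.
by rewrite iterS size_merge size_cat size_map IHe mulSn addnC.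
Qed.

Lemma leq_size_divisors (m n : nat) : (0 < n)%N -> (m %| n)%N ->
  (size (divisors m) <= size (divisors n))%N.
Proof.
move=> n0 mn; apply: uniq_leq_size (divisors_uniq m) _ => d.
have m0 : (0 < m)%N := dvdn_gt0 n0 mn.
by rewrite -!dvdn_divisors // => /dvdn_trans; apply.
Qed.

Lemma exp2_primes_leq_divisors (n : nat) : (2 ^ size (primes n) <= size (divisors n))%N.
Proof.
rewrite size_divisors; have : all (fun q => 0 < logn q n)%N (primes n).
  by apply/allP => q; rewrite logn_gt0.
elim: (primes n) => [|q s IH] /=; first by rewrite big_nil.
by case/andP => q0 qs; rewrite big_cons expnS leq_mul // IH.
Qed.

Section DivisorBound.

Variable R : realType.

(** Compare n^eps and the number of divisors prime by prime. If q^eps >= 2, then e + 1 <= 2^e <=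
    q^(eps e); each of the fewer than B smaller primes costs a factor c. *)
Lemma divisor_bound (eps : R) : 0 < eps ->
  exists2 c : R, 0 < c & forall n, (0 < n)%N ->
    (size (divisors n))%:R <= c * n%:R `^ eps.
Proof.
move=> eps0; pose de := 2 `^ eps - 1 : R.
have de0 : 0 < de.
  have : (1 : R) `^ eps < 2 `^ eps by apply: gt0_ltr_powR; rewrite ?nnegrE ?ler01 ?ler0n ?ltr1n.
  by rewrite powR1 subr_gt0.
(* Chosen so that c (1 + e de) >= e + 1, where 1 + e de <= 2^(eps e) by Bernoulli. *)
pose c := 1 + de^-1; have c1 : 1 <= c by rewrite lerDl invr_ge0 ltW.
pose B := (Num.truncn (2 `^ (eps^-1) : R)).+1.
have hB (q : nat) : (B <= q)%N -> 2 <= q%:R `^ eps :> R.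
  move=> Bq; have : 2 `^ eps^-1 <= q%:R :> R.
    by apply: ltW; apply: lt_le_trans (truncnS_gt _) _; rewrite ler_nat.
  move=> /(ge0_ler_powR (ltW eps0)).
  by rewrite !nnegrE powR_ge0 ler0n -powRrM mulVf ?gt_eqF // powRr1 // => /(_ isT isT).
have he (e : nat) : (e.+1)%:R <= c * 2 `^ eps ^+ e :> R.
  apply: le_trans (_ : c * (1 + e%:R * de) <= _); last first.
    rewrite ler_wpM2l ?(le_trans ler01) //.
    by rewrite -[X in _ <= X ^+ _](subrKC 1) bernoulli_ineq // ltW.
  have -> : c * (1 + e%:R * de) = 1 + e%:R + e%:R * de + de^-1.
    by rewrite /c; field; rewrite gt_eqF.
  rewrite -natr1.
  have : 0 <= de^-1 by rewrite invr_ge0 ltW.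
  have : 0 <= e%:R * de by rewrite mulr_ge0 // ltW.
  by lra.
have term (q e : nat) : prime q -> (e.+1)%:R <= (if (q < B)%N then c else 1) * q%:R `^ eps ^+ e :> R.
  move=> qp; case: ltnP => qB.
    apply: le_trans (he e) _; rewrite ler_wpM2l ?(le_trans ler01) //.
    rewrite lerXn2r ?nnegrE ?powR_ge0 // ge0_ler_powR ?nnegrE ?ler0n ?(ltW eps0) //.
    by rewrite ler_nat prime_gt1.
  rewrite mul1r; apply: le_trans (_ : 2 ^+ e <= _).
    by rewrite -natrX ler_nat ltn_expl.
  by rewrite lerXn2r ?nnegrE ?powR_ge0 // hB.
exists (c ^+ B) => [|n n0]; first by rewrite exprn_gt0 // (lt_le_trans ltr01).
rewrite size_divisors natr_prod.
have -> : n%:R `^ eps = \prod_(q <- primes n) (q%:R `^ eps) ^+ (logn q n) :> R.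
  rewrite {1}(prod_prime_decomp n0) prime_decompE big_map natr_prod.
  elim: (primes n) => [|q s IH]; first by rewrite !big_nil powR1.
  rewrite !big_cons powRM ?ler0n ?prodr_ge0 // IH natrX; congr (_ * _).
  by rewrite -(powR_mulrn _ (ler0n _ q)) -(powR_mulrn _ (powR_ge0 _ _)) powRAC.
have : \prod_(q <- primes n) (if (q < B)%N then c else 1) <= c ^+ B.
  rewrite -big_mkcond big_const_seq iter_mulr_1 ler_weXn2l //.
  rewrite -size_filter -[X in (_ <= X)%N](size_iota 0) uniq_leq_size //.
    by rewrite filter_uniq ?primes_uniq.
  by move=> q; rewrite mem_filter mem_iota => /andP[].
move=> h; apply: le_trans (ler_wpM2r _ h); last by rewrite prodr_ge0 // => q _; rewrite exprn_ge0 ?powR_ge0.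
rewrite -big_split /= big_seq [X in _ <= X]big_seq; apply: ler_prod => q.
by rewrite mem_primes => /andP[qp _]; rewrite ler0n term.
Qed.

End DivisorBound.

Section Sieve.

Variable R : realFieldType.

Definition sieve_count (qs : seq nat) (n : nat) : nat :=
  count (fun k => all (fun q => ~~ (q %| k)%N) qs) (iota 1 n).

Lemma count_multiples (P : pred nat) (q n : nat) : (0 < q)%N ->
  count (fun k => (q %| k)%N && P k) (iota 1 n) = count (fun k => P (q * k)%N) (iota 1 (n %/ q)).
Proof.
move=> q0; elim: n => [|n IH]; first by rewrite div0n.
have iS k : iota 1 k.+1 = iota 1 k ++ [:: k.+1] by rewrite -[in LHS](addn1 k) iotaD add1n.
rewrite iS count_cat IH /= addn0 divnS //.
case: (boolP (q %| n.+1)%N) => qn; last by rewrite add0n addn0.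
rewrite -[iota 1 (true + n %/ q)]/(iota 1 (n %/ q).+1) iS count_cat /= addn0; congr (_ + _)%N.
congr (nat_of_bool (P _)).
by rewrite -{1}(divnK qn) mulnC divnS // qn add1n.
Qed.

Lemma sieve_count_cons q qs n : prime q -> all prime qs -> q \notin qs ->
  sieve_count qs n = (sieve_count (q :: qs) n + sieve_count qs (n %/ q))%N.
Proof.
move=> qp qsp nq; rewrite /sieve_count.
have -> : count (fun k => all (fun q0 => ~~ (q0 %| k)%N) qs) (iota 1 (n %/ q)) =
   count (fun k => all (fun q0 => ~~ (q0 %| q * k)%N) qs) (iota 1 (n %/ q)).
  apply: eq_count => k /=; apply: eq_in_all => r rqs; congr negb.
  rewrite Gauss_dvdr // prime_coprime; last exact: (allP qsp).
  rewrite dvdn_prime2 //; last exact: (allP qsp).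
  by apply: contraNneq nq => <-.
rewrite -(count_multiples (fun k => all (fun q0 => ~~ (q0 %| k)%N) qs)) ?prime_gt0 //.
rewrite -count_predUI [X in (_ + X)%N](_ : _ = 0%N) ?addn0.
  by apply: eq_count => k /=; case: (q %| k)%N; rewrite /= ?orbF.
apply: etrans (count_pred0 (iota 1 n)); apply: eq_count => k /=.
by case: (q %| k)%N; rewrite /= ?andbF.
Qed.

(** Legendre's sieve: a further prime doubles the error and adds at most 1 for replacing n / q by
    its integer part, so an error E becomes at most 2 E + 1. *)
Lemma sieve_count_approx qs n : all prime qs -> uniq qs ->
  `|(sieve_count qs n)%:R - (\prod_(q <- qs) (1 - q%:R^-1)) * n%:R| <= 2 ^+ size qs - 1 :> R.
Proof.
elim: qs n => [|q qs IH] n /=.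
  rewrite big_nil mul1r /sieve_count count_predT size_iota subrr normr0.
  by rewrite expr0 subrr.
move=> /andP[qp qsp] /andP[nq uqs]; rewrite big_cons.
set th := \prod_(_ <- _) _ in IH *.
have th01 : 0 <= th <= 1.
  rewrite /th; elim: (qs) qsp => [|r rs IHr] /=; first by rewrite big_nil ler01 lexx.
  case/andP => rp /IHr /andP[h0 h1]; rewrite big_cons.
  have r1 : (1 : R) <= r%:R by rewrite ler1n prime_gt0.
  have r0 : (0 : R) < r%:R by rewrite (lt_le_trans ltr01).
  have i1 : 0 <= (1 : R) - r%:R^-1 by rewrite subr_ge0 invf_le1.
  by rewrite mulr_ge0 //= mulr_ile1 // gerBl invr_ge0 ltW.
have e : (sieve_count qs n)%:R = (sieve_count (q :: qs) n)%:R + (sieve_count qs (n %/ q))%:R :> R.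
  by rewrite (sieve_count_cons n qp qsp nq) natrD.
have q0 : (0 : R) < q%:R by rewrite ltr0n prime_gt0.
have dq : 0 <= (n%:R / q%:R - (n %/ q)%:R : R) <= 1.
  have nE : n%:R = (n %/ q)%:R * q%:R + (n %% q)%:R :> R by rewrite -natrM -natrD -divn_eq.
  have mq : (n %% q)%:R <= q%:R :> R by rewrite ler_nat ltnW // ltn_mod prime_gt0.
  by rewrite nE mulrDl mulfK ?gt_eqF // addrC addKr divr_ge0 //= ler_pdivrMr // mul1r.
have h1 := IH n qsp uqs; have h2 := IH (n %/ q)%N qsp uqs.
have h3 : `|th * (n%:R / q%:R - (n %/ q)%:R)| <= 1.
  case/andP: th01 => a0 a1; case/andP: dq => b0 b1.
  by rewrite ger0_norm ?mulr_ge0 // mulr_ile1.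
have -> : (sieve_count (q :: qs) n)%:R - (1 - q%:R^-1) * th * n%:R =
   ((sieve_count qs n)%:R - th * n%:R) - ((sieve_count qs (n %/ q))%:R - th * (n %/ q)%:R)
   + th * (n%:R / q%:R - (n %/ q)%:R) :> R by rewrite e; ring.
rewrite exprS; apply: le_trans (ler_normD _ _) _; apply: le_trans (lerD (ler_normB _ _) h3) _.
by move: h1 h2; set a := `|_ - _|; set b := `|_ - _|; set c := 2 ^+ _; lra.
Qed.

(** Each factor 1 - 1/q is at least 1/2, so the main term is at least n / 2^r. For n >= 2 4^r the
    error is at most half of that; for smaller n the survivor k = 1 is enough. *)
Lemma sieve_count_ge qs n : all prime qs -> uniq qs ->
  (n <= 2 * 4 ^ size qs * sieve_count qs n)%N.
Proof.
move=> qsp uqs; have happ := sieve_count_approx n qsp uqs.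
set r := size qs in happ *; set A := sieve_count qs n in happ *.
case: (posnP n) => [-> //|n0].
have [nr|nr] := ltnP n (2 * 4 ^ r).
  have A0 : (0 < A)%N.
    rewrite /A /sieve_count -has_count; apply/hasP; exists 1%N; first by rewrite mem_iota; lia.
    by apply/allP => q /(allP qsp) /prime_gt1; rewrite dvdn1; case: q => [|[|]].
  by apply: leq_trans (ltnW nr) _; rewrite leq_pmulr.
set th := \prod_(_ <- _) _ in happ.
have thr : 2 ^- r <= th.
  rewrite /th /r -exprVn; elim: (qs) qsp => [|q s IH] /=; first by rewrite big_nil expr0.
  case/andP => qp sp; rewrite big_cons exprS ler_pM ?exprn_ge0 ?invr_ge0 ?IH //.
  have : (q%:R : R)^-1 <= 2^-1.
    by rewrite lef_pV2 ?posrE ?ltr0n ?prime_gt0 // ler_nat prime_gt1.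
  by lra.
have r0 : 0 < 2 ^+ r :> R by rewrite exprn_gt0.
have nA : n%:R <= 2 * 2 ^+ r * A%:R :> R.
  have h1 : th * n%:R - 2 ^+ r <= A%:R.
    by move: happ; rewrite ler_norml => /andP[h _]; move: h; lra.
  have h2 : n%:R <= 2 ^+ r * (th * n%:R) :> R.
    rewrite mulrA ler_peMl //; move: thr; rewrite -(ler_pM2l r0) divff ?gt_eqF //.
  have h3 : 2 * (2 ^+ r * 2 ^+ r) <= n%:R :> R.
    by rewrite -exprMn -natrM -natrX -natrM ler_nat.
  move: h1; rewrite -(ler_pM2l r0) mulrBr => h1; lra.
have : (n <= 2 * 2 ^ r * A)%N.
  by rewrite -(ler_nat R) !natrM natrX.
move=> /leq_trans; apply; rewrite leq_mul2r leq_mul2l; apply/orP; right.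
by apply/orP; right; rewrite -[4%N]/(2 * 2)%N expnMn leq_pmulr ?expn_gt0.
Qed.

End Sieve.

Lemma count_coprime_ge (t n : nat) : (0 < t)%N ->
  (n <= 2 * size (divisors t) ^ 2 * count (fun k => coprime k t) (iota 1 n))%N.
Proof.
move=> t0; have pt : all prime (primes t) by apply/allP => q; rewrite mem_primes => /andP[].
have e : count (fun k => coprime k t) (iota 1 n) = sieve_count (primes t) n.
  apply: eq_in_count => k; rewrite mem_iota => /andP[k0 _] /=.
  rewrite coprime_has_primes // -all_predC; apply: eq_in_all => q qt /=.
  by rewrite mem_primes (allP pt) // k0.
rewrite e; apply: leq_trans (@sieve_count_ge rat _ n pt (primes_uniq t)) _.
rewrite leq_mul2r leq_mul2l -[4%N]/(2 ^ 2)%N -expnM mulnC expnM leq_sqr.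
by rewrite exp2_primes_leq_divisors !orbT.
Qed.

(** * Amplification by dilations *)

(** Lagrange's identity: twice the difference is the double sum of the squares (x_i y_j - x_j
    y_i)^2. *)
Lemma cauchy_schwarz_sum (R : realDomainType) (I : Type) (r : seq I) (P : pred I) (x y : I -> R) :
  (\sum_(i <- r | P i) x i * y i) ^+ 2 <=
  (\sum_(i <- r | P i) x i ^+ 2) * (\sum_(i <- r | P i) y i ^+ 2).
Proof.
rewrite -subr_ge0 -(pmulrn_lge0 _ (isT : (0 < 2)%N)).
have -> : ((\sum_(i <- r | P i) x i ^+ 2) * (\sum_(i <- r | P i) y i ^+ 2)
     - (\sum_(i <- r | P i) x i * y i) ^+ 2) *+ 2 =
   \sum_(i <- r | P i) \sum_(j <- r | P j) (x i * y j - x j * y i) ^+ 2.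
  pose a := \sum_(i <- r | P i) x i ^+ 2; pose b := \sum_(i <- r | P i) y i ^+ 2.
  pose c := \sum_(i <- r | P i) x i * y i.
  transitivity (\sum_(i <- r | P i) (x i ^+ 2 * b + y i ^+ 2 * a - (x i * y i) * c *+ 2)).
    by rewrite sumrB big_split /= -!mulr_suml sumrMnl -mulr_suml -/a -/b -/c; ring.
  apply: eq_bigr => i _; rewrite /a /b /c !mulr_sumr -sumrMnl -big_split /= -sumrB.
  by apply: eq_bigr => j _; ring.
by apply: sumr_ge0 => i _; apply: sumr_ge0 => j _; apply: sqr_ge0.
Qed.

Section NormSums.

Variable R : realType.
Local Notation C := (R[i]).

Lemma normc_conj (x : C) : normc (x^*)%C = normc x.
Proof. by apply: (@complexI R); rewrite -!normC_normc normcJ. Qed.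

Lemma sqr_normcE (x : C) : (normc x ^+ 2)%:C%C = x * (x^*)%C.
Proof. by rewrite rmorphXn /= -normC_normc sqr_normc. Qed.

Lemma normc_real (x : R) : 0 <= x -> normc (x%:C)%C = x.
Proof. by move=> x0; apply: (@complexI R); rewrite -normC_normc ger0_norm // lecR. Qed.

Lemma cauchy_schwarz_normc (I : Type) (r : seq I) (P : pred I) (x y : I -> C) :
  normc (\sum_(i <- r | P i) x i * y i) ^+ 2 <=
  (\sum_(i <- r | P i) normc (x i) ^+ 2) * (\sum_(i <- r | P i) normc (y i) ^+ 2).
Proof.
have := cauchy_schwarz_sum r P (fun i => normc (x i)) (fun i => normc (y i)).
apply: le_trans.
rewrite lerXn2r ?nnegrE ?normc_ge0 ?sumr_ge0 //=.
  by move=> i _; rewrite mulr_ge0 ?normc_ge0.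
by apply: le_trans (ler_normc_sum _ _ _) _; apply: ler_sum => i _; rewrite normcM.
Qed.

Lemma sum_sqr_normc_le (I V : finType) (c : I -> C) (F : I -> V -> C) :
  \sum_v normc (\sum_i c i * F i v) ^+ 2 <=
  \sum_i \sum_j normc (c i) * normc (c j) * normc (\sum_v F i v * (F j v)^*%C).
Proof.
have e : (\sum_v normc (\sum_i c i * F i v) ^+ 2)%:C%C =
    \sum_i \sum_j c i * (c j)^*%C * \sum_v F i v * (F j v)^*%C.
  rewrite rmorph_sum /=.
  transitivity (\sum_v \sum_i \sum_j c i * (c j)^*%C * (F i v * (F j v)^*%C)).
    apply: eq_bigr => v _; rewrite sqr_normcE rmorph_sum /= mulr_suml.
    apply: eq_bigr => i _; rewrite mulr_sumr; apply: eq_bigr => j _.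
    by rewrite rmorphM mulrACA.
  rewrite exchange_big; apply: eq_bigr => i _; rewrite exchange_big.
  by apply: eq_bigr => j _; rewrite mulr_sumr.
rewrite -[X in X <= _]normc_real ?e; last by apply: sumr_ge0 => v _; rewrite sqr_ge0.
apply: le_trans (ler_normc_sum _ _ _) _; apply: ler_sum => i _.
apply: le_trans (ler_normc_sum _ _ _) _; apply: ler_sum => j _.
by rewrite !normcM normc_conj.
Qed.

End NormSums.

Section Amplification.

Variables (R : realType) (gT : finGroupType) (V : finType) (act : gT -> V -> V).
Hypotheses (actM : forall g h v, act (g * h)%g v = act g (act h v))
  (act_inj : forall g, injective (act g)).
Local Notation C := (R[i]).
Variables (f : V -> C) (e : gT -> C) (A : {set gT}) (W : R).
Hypotheses (f_le1 : forall v, normc (f v) <= 1) (e_le1 : forall u, normc (e u) <= 1).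
Hypothesis A_gt0 : (0 < #|A|)%N.
Hypothesis W_ge0 : 0 <= W.
Hypothesis corr : {in A &, forall k l, k != l ->
   normc (\sum_v f (act k v) * (f (act l v))^*%C) <= W}.

Let G v := \sum_u e u * f (act u v).
Let Q := \sum_v normc (G v) ^+ 2.
Let M := \sum_u normc (e u).
Let H r v := \sum_(k in A) e (k * r^-1)%g * f (act k v).
Let n r := \sum_(k in A) normc (e (k * r^-1)%g).
Let t := #|V|%:R : R.

(* In <f(u .), G> the variable is dilated by u^-1 k, for every k in A; the
   resulting terms are grouped according to r = u^-1 k. *)
Lemma amplified_norm : #|A|%:R * Q <= \sum_r normc (\sum_v H r v * (G (act r v))^*%C).
Proof.
have Q0 : 0 <= Q by apply: sumr_ge0 => v _; rewrite sqr_ge0.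
have key : (#|A|%:R * Q)%:C%C = \sum_r \sum_v H r v * (G (act r v))^*%C.
  have QE : Q%:C%C = \sum_u e u * \sum_v f (act u v) * (G v)^*%C.
    rewrite rmorph_sum /=; under eq_bigr do rewrite sqr_normcE {1}/G mulr_suml.
    rewrite exchange_big; apply: eq_bigr => u _; rewrite mulr_sumr.
    by apply: eq_bigr => v _; rewrite mulrA.
  rewrite rmorphM /= rmorph_nat -sum1_card natr_sum mulr_suml.
  transitivity (\sum_(k in A) \sum_r e (k * r^-1)%g * \sum_v f (act k v) * (G (act r v))^*%C).
    apply: eq_bigr => k _; rewrite mul1r QE.
    rewrite (reindex_inj (h := fun r => (k * r^-1)%g)) /=; last first.
      by move=> r s /mulgI /invg_inj.
    apply: eq_bigr => r _; congr (_ * _).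
    rewrite (reindex_inj (@act_inj r)) /=; apply: eq_bigr => v _.
    by rewrite -actM mulgKV.
  rewrite exchange_big; apply: eq_bigr => r _.
  under eq_bigr do rewrite mulr_sumr.
  rewrite exchange_big; apply: eq_bigr => v _; rewrite /H mulr_suml.
  by apply: eq_bigr => k _; rewrite mulrA.
rewrite -[X in X <= _]normc_real ?key ?ler_normc_sum //.
by rewrite mulr_ge0.
Qed.

(** Diagonal pairs cost t each, weighted by |c|^2 <= |c|; off-diagonal pairs cost W. *)
Lemma sum_sqr_H r : \sum_v normc (H r v) ^+ 2 <= t * n r + n r ^+ 2 * W.
Proof.
have n_ge0 : 0 <= n r by apply: sumr_ge0 => k _; apply: normc_ge0.
have diag k : normc (\sum_v f (act k v) * (f (act k v))^*%C) <= t.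
  apply: le_trans (ler_normc_sum _ _ _) _; rewrite /t -sum1_card natr_sum.
  by apply: ler_sum => v _; rewrite normcM normc_conj mulr_ile1 ?normc_ge0.
pose c k := if k \in A then e (k * r^-1)%g else 0.
have HE v : H r v = \sum_k c k * f (act k v).
  by rewrite /H big_mkcond; apply: eq_bigr => k _; rewrite /c; case: ifP; rewrite ?mul0r.
under eq_bigr do rewrite HE.
apply: le_trans (sum_sqr_normc_le c (fun k v => f (act k v))) _.
have nE : n r = \sum_k normc (c k).
  by rewrite /n big_mkcond; apply: eq_bigr => k _; rewrite /c; case: ifP; rewrite ?normc0.
apply: le_trans (_ : \sum_k \sum_l ((if k == l then t * normc (c k) else 0)
     + normc (c k) * normc (c l) * W) <= _); last first.
  have -> : \sum_k \sum_l ((if k == l then t * normc (c k) else 0)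
      + normc (c k) * normc (c l) * W) = t * n r + n r ^+ 2 * W; last by [].
    rewrite nE expr2 -mulrA mulr_sumr [X in _ + X]mulr_suml -big_split /=.
    apply: eq_bigr => k _; rewrite big_split /= -big_mkcond (big_pred1 k) => [|l].
      by congr (_ + _); rewrite mulr_suml mulr_sumr; apply: eq_bigr => l _; rewrite mulrA.
    by rewrite /= eq_sym.
apply: ler_sum => k _; apply: ler_sum => l _.
have ck0 := normc_ge0 (c k); have cl0 := normc_ge0 (c l).
have [-> | kl] := eqVneq k l.
  rewrite ler_wpDr ?mulr_ge0 // mulrC mulrA ler_wpM2r // -[t]mulr1 ler_pM ?normc_ge0 //.
  by rewrite /c; case: ifP => _; rewrite ?normc0 ?e_le1.
rewrite add0r /c; case: ifP => kA; last by rewrite normc0 !mul0r.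
case: ifP => lA; last by rewrite normc0 mulr0 !mul0r.
by rewrite ler_wpM2l ?mulr_ge0 ?normc_ge0 ?corr.
Qed.

Lemma sum_n : \sum_r n r = #|A|%:R * M.
Proof.
rewrite exchange_big -sum1_card natr_sum mulr_suml; apply: eq_bigr => k _.
rewrite mul1r /M [RHS](reindex_inj (h := fun r => (k * r^-1)%g)) //.
by move=> r s /mulgI /invg_inj.
Qed.

(** For each r, Cauchy-Schwarz separates H from G(r v), whose square sum is again Q because r
    permutes V. A second application over r handles the square roots of n(r), whose total is |A|
    M. *)
Lemma amplification :
  Q <= 2 * (#|gT|%:R * t * M / #|A|%:R + M ^+ 2 * W).
Proof.
have Q_ge0 : 0 <= Q by apply: sumr_ge0 => v _; rewrite sqr_ge0.
have M_ge0 : 0 <= M by apply: sumr_ge0 => u _; apply: normc_ge0.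
have n_ge0 r : 0 <= n r by apply: sumr_ge0 => k _; apply: normc_ge0.
have t_ge0 : 0 <= t by apply: ler0n.
have K_gt0 : 0 < #|A|%:R :> R by rewrite ltr0n.
have term r : normc (\sum_v H r v * (G (act r v))^*%C) <=
    Num.sqrt Q * (Num.sqrt (t * n r) + n r * Num.sqrt W).
  have tn0 : 0 <= t * n r by rewrite mulr_ge0.
  have s0 : 0 <= Num.sqrt (t * n r) + n r * Num.sqrt W.
    by rewrite addr_ge0 ?mulr_ge0 ?sqrtr_ge0.
  rewrite -ler_sqr ?nnegrE ?normc_ge0 ?mulr_ge0 ?sqrtr_ge0 // exprMn sqr_sqrtr //.
  apply: le_trans (cauchy_schwarz_normc _ _ _ _) _; rewrite mulrC.
  have -> : \sum_v normc ((G (act r v))^*%C) ^+ 2 = Q.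
    under eq_bigr do rewrite normc_conj.
    by rewrite [RHS](reindex_inj (@act_inj r)).
  rewrite ler_wpM2l //; apply: le_trans (sum_sqr_H r) _.
  rewrite sqrrD exprMn !sqr_sqrtr //.
  rewrite -addrA lerD2l lerDr mulrn_wge0 // !mulr_ge0 ?sqrtr_ge0 //.
pose a := \sum_r Num.sqrt (t * n r); pose b := #|A|%:R * M * Num.sqrt W.
have KQ : #|A|%:R * Q <= Num.sqrt Q * (a + b).
  apply: le_trans amplified_norm _.
  rewrite /a /b -sum_n mulr_suml -big_split mulr_sumr /=.
  by apply: ler_sum => r _; apply: term.
have a_ge0 : 0 <= a by apply: sumr_ge0 => r _; apply: sqrtr_ge0.
have b_ge0 : 0 <= b by rewrite /b mulr_ge0 ?sqrtr_ge0 // mulr_ge0.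
have a2 : a ^+ 2 <= #|gT|%:R * (t * (#|A|%:R * M)).
  have := cauchy_schwarz_sum (index_enum gT) xpredT (fun=> 1) (fun r => Num.sqrt (t * n r)).
  under eq_bigr do rewrite mul1r.
  move/le_trans; apply; rewrite le_eqVlt; apply/orP; left; apply/eqP; congr (_ * _).
    by rewrite expr1n sumr_const.
  by under eq_bigr do rewrite sqr_sqrtr ?mulr_ge0 //; rewrite -mulr_sumr sum_n.
have b2 : b ^+ 2 = #|A|%:R ^+ 2 * (M ^+ 2 * W).
  by rewrite /b !exprMn sqr_sqrtr // mulrA.
(* One factor sqrt Q cancels; Q = 0 is treated apart. *)
have K2Q : #|A|%:R ^+ 2 * Q <= (a + b) ^+ 2.
  have [->|Qn0] := eqVneq Q 0; first by rewrite mulr0 sqr_ge0.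
  have Qgt0 : 0 < Q by rewrite lt_neqAle eq_sym Qn0.
  have sQ : 0 < Num.sqrt Q by rewrite sqrtr_gt0.
  have h : #|A|%:R * Num.sqrt Q <= a + b.
    by rewrite -(ler_pM2l sQ) mulrCA -expr2 sqr_sqrtr.
  rewrite -{1}[Q]sqr_sqrtr // -exprMn ler_sqr ?nnegrE ?mulr_ge0 ?addr_ge0 ?sqrtr_ge0 //.
have K2 : 0 < #|A|%:R ^+ 2 :> R by rewrite exprn_gt0.
rewrite -(ler_pM2l K2); apply: le_trans K2Q _.
have -> : #|A|%:R ^+ 2 * (2 * (#|gT|%:R * t * M / #|A|%:R + M ^+ 2 * W)) =
   2 * (#|gT|%:R * (t * (#|A|%:R * M)) + b ^+ 2) :> R.
  by rewrite b2; field; rewrite gt_eqF.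
apply: le_trans (_ : 2 * (a ^+ 2 + b ^+ 2) <= _); last by rewrite ler_pM2l // lerD2r.
by rewrite -subr_ge0 (_ : _ - _ = (a - b) ^+ 2) ?sqr_ge0 //; ring.
Qed.

End Amplification.

(** * One divisor class of exponents *)

Lemma sum_periodic (A : nmodType) (F : nat -> A) (t d : nat) :
  (forall y, F (y + t)%N = F y) ->
  \sum_(0 <= y < d * t) F y = (\sum_(0 <= y < t) F y) *+ d.
Proof.
move=> per; elim: d => [|d IH]; first by rewrite mul0n big_geq.
rewrite mulSn (@big_cat_nat _ _ _ t) ?leq_addr //= mulrS; congr (_ + _).
rewrite -{1}[t]add0n big_addn addKn -IH; apply: eq_bigr => y _; exact: per.
Qed.

Lemma big_Zp (A : nmodType) (t : nat) (F : nat -> A) : (1 < t)%N ->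
  \sum_(v : 'Z_t) F v = \sum_(0 <= y < t) F y.
Proof. by move=> t1; rewrite -[in RHS](Zp_cast t1) big_mkord. Qed.

Section ExponentialSums.

Variables (R : realType) (p : nat) (p_pr : prime p) (gam a : 'F_p) (psi : 'F_p -> R[i]).
Hypotheses (gam_prim : p.-1.-primitive_root gam) (a0 : a != 0).
Hypotheses (psiD : {morph psi : x y / x + y >-> x * y}) (psi0 : psi 0 = 1)
  (psi_norm : forall x, normc (psi x) = 1) (psi_nontriv : exists b, psi b != 1).
Local Notation F := 'F_p.
Local Notation C := (R[i]).
Local Notation T := p.-1.

Lemma psi_conj x : (psi x)^*%C = psi (- x).
Proof.
have nz : psi x != 0 by rewrite -normc_eq0 psi_norm oner_eq0.
apply: (mulfI nz); rewrite -sqr_normcE psi_norm expr1n rmorph1 -psiD subrr psi0.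
by [].
Qed.

Lemma sum_primitive_root (A : nmodType) (G : F -> A) :
  \sum_x G x = G 0 + \sum_(0 <= y < T) G (gam ^+ y).
Proof.
have T0 : (0 < T)%N by apply: prim_order_gt0 gam_prim.
have g0 : gam != 0 by rewrite (prim_root_eq0 gam_prim) -lt0n.
rewrite (bigD1 0) //=; congr (_ + _).
rewrite -big_filter -[RHS](big_map (fun y => gam ^+ y) xpredT G); apply: perm_big.
apply: uniq_perm; first by rewrite filter_uniq ?index_enum_uniq.
  rewrite map_inj_in_uniq ?iota_uniq // => i j; rewrite !mem_index_iota /= => iT jT /eqP.
  by rewrite (eq_prim_root_expr gam_prim) !modn_small // => /eqP.
move=> x; rewrite mem_filter mem_index_enum andbT; apply/idP/mapP => [x0|[y _ ->]].
  have xT : x ^+ T = 1.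
    by apply: (mulfI x0); rewrite -exprS prednK ?prime_gt0 // Fp_expp // mulr1.
  have [i ->] := prim_rootP gam_prim xT.
  by exists (i : nat) => //; rewrite mem_index_iota /= ltn_ord.
by rewrite expf_neq0.
Qed.

(** The powers of [gam] miss only x = 0, which contributes 1, and (k - 1) sqrt p + 1 <= k sqrt p. *)
Lemma binomial_sum_bound (k l : nat) : (0 < l < k)%N -> (k < p)%N ->
  normc (\sum_(0 <= y < T) psi (a * ((gam ^+ y) ^+ k - (gam ^+ y) ^+ l)))
    <= k%:R * Num.sqrt p%:R.
Proof.
case/andP=> l0 lk kp; have k0 : (0 < k)%N by apply: ltn_trans lk.
pose f : {poly F} := a *: ('X^k - 'X^l).
have sf : size f = k.+1.
  by rewrite size_scale // size_polyDl size_polyXn // size_polyN size_polyXn ltnS.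
have pk : ~~ (p %| k)%N by rewrite gtnNdvd.
have := weil_bound p_pr k0 sf pk psiD psi0 psi_norm psi_nontriv.
rewrite (sum_primitive_root (fun x => psi f.[x])).
have fE x : f.[x] = a * (x ^+ k - x ^+ l) by rewrite /f !hornerE.
rewrite fE !expr0n !gtn_eqF // subrr mulr0 psi0 => h.
under eq_bigr do rewrite -fE.
set S := \sum_(0 <= y < T) _ in h *.
have p1 : 1 <= Num.sqrt p%:R :> R.
  by rewrite -[X in X <= _]sqrtr1 ler_wsqrtr // ler1n prime_gt0.
have : normc S <= normc (1 + S) + 1.
  by rewrite -{1}[S](addKr 1) addrC (le_trans (le_normcD _ _)) // normcN normc1.
move/le_trans; apply; apply: le_trans (lerD h p1) _.
by rewrite -{2}(prednK k0) -natr1 mulrDl mul1r.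
Qed.

Section DivisorClass.

Variables (d t : nat).
Hypotheses (dt : (d * t = T)%N) (t1 : (1 < t)%N).
Let d0 : (0 < d)%N.
Proof. by case: d dt (prim_order_gt0 gam_prim) => // <-; rewrite mul0n. Qed.

Definition class_fun (v : 'Z_t) : C := psi (a * (gam ^+ d) ^+ v).

Lemma class_funE (n : nat) : class_fun (n%:R) = psi (a * (gam ^+ d) ^+ n).
Proof.
rewrite /class_fun val_Zp_nat //; congr (psi (a * _)).
by rewrite -!exprM -(prim_expr_mod gam_prim) -[RHS](prim_expr_mod gam_prim) -dt
   -!muln_modr modn_mod.
Qed.

Lemma class_funM (k v : 'Z_t) :
  class_fun (k * v) = psi (a * (gam ^+ v) ^+ (d * k)).
Proof.
have -> : k * v = ((k : nat) * (v : nat))%N%:R by rewrite natrM !natr_Zp.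
by rewrite class_funE -!exprM; congr (psi (a * gam ^+ _)); ring.
Qed.

Lemma val_unit_gt0 (u : {unit 'Z_t}) : (0 < (val u : nat))%N.
Proof.
rewrite lt0n; apply: contraTneq (valP u) => u0.
have -> : val u = 0 by apply: val_inj.
by rewrite unitr0.
Qed.

(** The binomial sum over all non-zero residues, of degree at most d D, consists of d equal periods
    of length t; dividing by d leaves D. *)
Lemma class_corr (D : nat) (k l : {unit 'Z_t}) : (d * D < p)%N ->
  (val k <= D)%N -> (val l <= D)%N -> k != l ->
  normc (\sum_v class_fun (val k * v) * (class_fun (val l * v))^*%C)
   <= D%:R * Num.sqrt p%:R.
Proof.
move=> dD.
have prodE (u w : {unit 'Z_t}) v : class_fun (val u * v) * (class_fun (val w * v))^*%C =
    psi (a * ((gam ^+ v) ^+ (d * val u) - (gam ^+ v) ^+ (d * val w))).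
  by rewrite !class_funM psi_conj -psiD -mulrBr.
wlog lk : k l / ((val l : nat) < val k)%N.
  move=> hw kD lD kl; have [lk|kl'|e] := ltngtP (val l : nat) (val k); first exact: hw.
    have h : normc (\sum_v class_fun (val l * v) * (class_fun (val k * v))^*%C)
        <= D%:R * Num.sqrt p%:R by apply: hw => //; rewrite eq_sym.
    rewrite -normc_conj rmorph_sum /= in h.
    apply: le_trans h; rewrite le_eqVlt; apply/orP; left; apply/eqP; congr (normc _).
    by apply: eq_bigr => v _; rewrite !prodE psi_conj -mulrN opprB.
  by case/eqP: kl; apply: val_inj; apply: val_inj.
move=> kD lD _.
have kp : (d * val k < p)%N by apply: leq_ltn_trans dD; rewrite leq_mul2l kD orbT.
have := @binomial_sum_bound (d * val k) (d * val l) _ kp.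
rewrite muln_gt0 d0 val_unit_gt0 ltn_pmul2l // lk => /(_ isT).
rewrite -{1}dt sum_periodic => [|y]; last first.
  have e n : (gam ^+ (y + t)) ^+ (d * n) = (gam ^+ y) ^+ (d * n).
    rewrite -!exprM -(prim_expr_mod gam_prim) -[RHS](prim_expr_mod gam_prim) -dt.
    by rewrite mulnDl addnC mulnA [(t * d)%N]mulnC [(d * t * n)%N]mulnC modnMDl.
  by rewrite !e.
rewrite normcMn -[_ *+ d]mulr_natl natrM -mulrA ler_pM2l ?ltr0n // => h.
apply: le_trans (le_trans _ h) _; last by rewrite ler_wpM2r ?sqrtr_ge0 ?ler_nat.
rewrite -(big_Zp (fun y => psi (a * (gam ^+ y ^+ (d * val k) - gam ^+ y ^+ (d * val l)))) t1).
rewrite le_eqVlt; apply/orP; left; apply/eqP; congr (normc _); apply: eq_bigr => v _.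
by rewrite prodE.
Qed.

Lemma card_unit_Zp_le : (#|{: {unit 'Z_t}}| <= t.-1)%N.
Proof.
rewrite -[X in (_ <= X)%N](size_iota 1) cardE.
have -> : size (enum {: {unit 'Z_t}}) = size [seq nat_of_ord (val u) | u : {unit 'Z_t} <- enum {: {unit 'Z_t}}].
  by rewrite size_map.
apply: uniq_leq_size.
  by rewrite map_inj_uniq ?enum_uniq // => u w /val_inj /val_inj.
move=> n /mapP[u _ ->]; rewrite mem_iota val_unit_gt0 /=.
by rewrite add1n prednK ?(ltnW t1) // -[X in (_ < X)%N](Zp_cast t1) ltn_ord.
Qed.

Lemma card_small_units (D : nat) : (D < t)%N ->
  (D <= 2 * size (divisors t) ^ 2 * #|[set k : {unit 'Z_t} | (val k <= D)%N]|)%N.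
Proof.
move=> Dt; apply: leq_trans (count_coprime_ge D (ltnW t1)) _.
rewrite leq_mul2l; apply/orP; right.
rewrite -size_filter cardE -(size_map (fun u : {unit 'Z_t} => (val u : nat))).
apply: uniq_leq_size; first by rewrite filter_uniq ?iota_uniq.
move=> k; rewrite mem_filter mem_iota => /andP[kt /andP[k0 kD]].
have ku : (k%:R : 'Z_t) \is a GRing.unit by rewrite unitZpE // coprime_sym.
have vk : (k%:R : 'Z_t) = k :> nat.
  by rewrite val_Zp_nat // modn_small // (leq_ltn_trans _ Dt).
apply/mapP; exists (FinRing.unit 'Z_t ku); last by rewrite /= vk.
by rewrite mem_enum inE /= vk -ltnS -add1n.
Qed.

Lemma class_bound (e : {unit 'Z_t} -> C) : (forall u, normc (e u) <= 1) ->
  d%:R * \sum_v normc (\sum_u e u * class_fun (val u * v)) ^+ 2 <=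
  10 * (size (divisors T))%:R ^+ 2 * (Num.sqrt (Num.sqrt p%:R)) ^+ 5 *
    Num.sqrt (\sum_u normc (e u)) ^+ 3.
Proof.
move=> e1; set m := \sum_u normc (e u); set Q := \sum_v _; set tau := size (divisors T).
set q := Num.sqrt (Num.sqrt p%:R); set s := Num.sqrt m.
have m_ge0 : 0 <= m by apply: sumr_ge0 => u _; apply: normc_ge0.
have s2 : s ^+ 2 = m by rewrite sqr_sqrtr.
have q2 : q ^+ 2 = Num.sqrt p%:R by rewrite sqr_sqrtr ?sqrtr_ge0.
have q4 : q ^+ 4 = p%:R by rewrite (exprM q 2 2) q2 sqr_sqrtr ?ler0n.
have q_gt0 : 0 < q by rewrite !sqrtr_gt0 ltr0n prime_gt0.
have s_ge0 : 0 <= s := sqrtr_ge0 m.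
have tau1 : 1 <= tau%:R :> R.
  rewrite ler1n; have := divisor1 T; rewrite -has_pred1 has_count => h.
  by apply: leq_trans h (count_size _ _).
have f1 v : normc (class_fun v) <= 1 by rewrite psi_norm.
have Tp : (T < p)%N by rewrite prednK // prime_gt0.
have dtR : d%:R * t%:R <= q ^+ 4.
  by rewrite q4 -natrM dt ler_nat ltnW.
have dR : 0 < d%:R :> R by rewrite ltr0n.
have tR : 0 < t%:R :> R by rewrite ltr0n ltnW.
have tau2 : 1 <= tau%:R ^+ 2 :> R by rewrite -[X in X <= _](expr1n _ 2) ler_sqr ?nnegrE ?ler0n ?ler01.
(* Here q = p^(1/4) and s = sqrt m. If s <= q, the trivial bound d t m^2 <= q^4 s^4 already
   suffices. *)
have [sq|qs] := lerP s q.
  have triv : Q <= t%:R * m ^+ 2.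
    have -> : t%:R * m ^+ 2 = \sum_(v : 'Z_t) m ^+ 2 :> R.
      by rewrite sumr_const card_ord Zp_cast // mulr_natl.
    apply: ler_sum => v _; rewrite ler_sqr ?nnegrE ?normc_ge0 //.
    apply: le_trans (ler_normc_sum _ _ _) _; apply: ler_sum => u _.
    by rewrite normcM ler_piMr ?normc_ge0.
  apply: le_trans (ler_wpM2l (ltW dR) triv) _.
  rewrite mulrA -s2 -exprM; apply: le_trans (ler_wpM2r _ dtR) _; first exact: exprn_ge0.
  have X0 : 0 <= q ^+ 5 * s ^+ 3 by apply: mulr_ge0; apply: exprn_ge0; rewrite // ltW.
  apply: le_trans (_ : q ^+ 5 * s ^+ 3 <= _).
    have -> : q ^+ 4 * s ^+ (2 * 2) = q ^+ 4 * s ^+ 3 * s by ring.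
    have -> : q ^+ 5 * s ^+ 3 = q ^+ 4 * s ^+ 3 * q by ring.
    by rewrite ler_wpM2l // mulr_ge0 // exprn_ge0 // ltW.
  rewrite -[_ * q ^+ 5 * _]mulrA ler_peMl //; lra.
have mt : m <= t%:R - 1.
  apply: le_trans (_ : \sum_(u : {unit 'Z_t}) 1 <= _); first exact: ler_sum.
  rewrite sumr_const -(natrB _ (ltnW t1)) ler_nat subn1; exact: card_unit_Zp_le.
(* From d s q <= d m < d t <= q^4; it guarantees D >= 1. *)
have ds : d%:R * s < q ^+ 3.
  rewrite -(ltr_pM2r q_gt0) -exprSr; apply: lt_le_trans dtR.
  apply: le_lt_trans (_ : d%:R * m < _); last by rewrite ltr_pM2l //; lra.
  by rewrite -mulrA ler_pM2l // -s2 expr2 ler_wpM2l // ltW.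
have s_gt0 : 0 < s by apply: lt_trans qs.
(* The diagonal term q^8 s^2 / (d D) and the off-diagonal term d D s^4 q^2 agree for d D = q^3 / s,
   with common value q^5 s^3. *)
pose Dr := q ^+ 3 / (d%:R * s); pose D := Num.truncn Dr.
have Dr1 : 1 <= Dr by rewrite ler_pdivlMr ?mulr_gt0 // mul1r ltW.
have D_le : D%:R <= Dr by rewrite truncn_le // (le_trans ler01).
have D_gt : Dr < D.+1%:R by apply: truncnS_gt.
have D1 : (0 < D)%N by rewrite truncn_gt0.
have dDq : (d * D)%:R < q ^+ 2 :> R.
  rewrite natrM; apply: le_lt_trans (ler_wpM2l (ltW dR) D_le) _.
  have -> : d%:R * Dr = q ^+ 2 * (q / s) by rewrite /Dr; field; rewrite !gt_eqF.
  by rewrite gtr_pMr ?exprn_gt0 // ltr_pdivrMr // mul1r.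
have dD2 : ((d * D) ^ 2 < p)%N.
  rewrite -(ltr_nat R) -q4 natrX -[4%N]/(2 * 2)%N exprM ltr_sqr ?nnegrE ?ler0n //.
  by rewrite exprn_ge0 // ltW.
have dDp : (d * D < p)%N by apply: leq_ltn_trans dD2; rewrite leq_pmulr // muln_gt0 d0 D1.
(* Otherwise d D >= d t, and (d D)^2 <= p - 1 = d t would contradict d t > 1. *)
have Dt : (D < t)%N.
  rewrite -(ltn_pmul2l d0) dt; move: dD2; rewrite -(prednK (prime_gt0 p_pr)) /= ltnS -dt.
  have : (1 < d * t)%N by apply: leq_trans t1 _; rewrite leq_pmull.
  rewrite -mulnn; move: (d * D)%N (d * t)%N => x y y1 xy.
  rewrite ltnNge; apply/negP => yx; have := leq_trans (leq_mul yx yx) xy.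
  by rewrite leqNgt ltn_Pmull // ltnW.
pose A := [set k : {unit 'Z_t} | (val k <= D)%N].
have AD : (D <= 2 * tau ^ 2 * #|A|)%N.
  apply: leq_trans (card_small_units Dt) _; rewrite leq_mul2r leq_mul2l leq_sqr.
  by rewrite leq_size_divisors ?orbT // -?dt ?dvdn_mull // dt (prim_order_gt0 gam_prim).
have A0 : (0 < #|A|)%N.
  by move: AD; case: #|A| => //; rewrite muln0 leqn0 => /eqP D0; rewrite D0 in D1.
have amp : Q <= 2 * (#|{: {unit 'Z_t}}|%:R * #|'Z_t|%:R * m / #|A|%:R + m ^+ 2 * (D%:R * Num.sqrt p%:R)).
  apply: (@amplification R {unit 'Z_t} 'Z_t (fun u v => val u * v)) => //.
  - by move=> g h v; rewrite /= mulrA.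
  - by move=> g v w /= /(mulrI (valP g)).
  - by rewrite mulr_ge0 ?sqrtr_ge0.
  - by move=> k l; rewrite !inE => kD lD kl; apply: class_corr.
have A_gt0 : 0 < #|A|%:R :> R by rewrite ltr0n.
apply: le_trans (ler_wpM2l (ltW dR) amp) _.
have cZ : #|'Z_t| = t by rewrite card_ord Zp_cast.
rewrite cZ -q2.
pose X := q ^+ 5 * s ^+ 3; have X0 : 0 <= X by apply: mulr_ge0; apply: exprn_ge0; rewrite // ltW.
have h1 : d%:R * (#|{: {unit 'Z_t}}|%:R * t%:R * m / #|A|%:R) <= 4 * (tau%:R ^+ 2 * X).
  rewrite [4 * _]mulrA mulrA ler_pdivrMr //.
  (* Truncation costs a factor 2, since Dr < D + 1 <= 2 D. With the 2 from the sieve this gives 4,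
     and 10 = 2 (4 + 1) in the end. *)
  have K4 : Dr <= 4 * tau%:R ^+ 2 * #|A|%:R.
    have h : D%:R <= 2 * tau%:R ^+ 2 * #|A|%:R :> R by rewrite -natrX -!natrM ler_nat.
    have h' : 1 <= D%:R :> R by rewrite ler1n.
    by move: D_gt; rewrite -natr1; lra.
  have -> : 4 * tau%:R ^+ 2 * X * #|A|%:R = X * (4 * tau%:R ^+ 2 * #|A|%:R) by ring.
  apply: le_trans (ler_wpM2l X0 K4).
  have -> : X * Dr = q ^+ 8 * s ^+ 2 / d%:R by rewrite /X /Dr; field; rewrite !gt_eqF.
  rewrite s2 ler_pdivlMr //.
  have g_le : #|{: {unit 'Z_t}}|%:R <= t%:R :> R.
    by rewrite ler_nat (leq_trans card_unit_Zp_le) // leq_pred.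
  have -> : d%:R * (#|{: {unit 'Z_t}}|%:R * t%:R * m) * d%:R =
      (d%:R * #|{: {unit 'Z_t}}|%:R) * (d%:R * t%:R) * m by ring.
  rewrite ler_wpM2r // (exprD q 4 4) ler_pM //; try by rewrite mulr_ge0 // ltW.
  by apply: le_trans dtR; rewrite ler_pM2l.
have h2 : d%:R * (m ^+ 2 * (D%:R * q ^+ 2)) <= X.
  have -> : X = d%:R * (m ^+ 2 * (Dr * q ^+ 2)).
    by rewrite -s2 /X /Dr; field; rewrite !gt_eqF.
  by rewrite ler_pM2l // ler_wpM2l ?sqr_ge0 // ler_wpM2r ?sqr_ge0.
have -> : 10 * tau%:R ^+ 2 * q ^+ 5 * s ^+ 3 = 10 * (tau%:R ^+ 2 * X) by rewrite /X; ring.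
have h3 : X <= tau%:R ^+ 2 * X by rewrite ler_peMl.
rewrite [d%:R * _]mulrCA [d%:R * (_ + _)]mulrDr; move: h1 h2 h3.
by move: (_ * (_ / _)) (d%:R * (m ^+ 2 * _)) (tau%:R ^+ 2 * X) => u v y; lra.
Qed.

End DivisorClass.

End ExponentialSums.

(** * The bilinear form *)

(** Writing x = d x', the gcd condition says that x' is prime to t. As t > 1 this excludes x' = t,
    so x' is the representative of a unit modulo t. *)
Lemma sum_gcd_class (A : nmodType) (G : nat -> A) (d t n1 n2 : nat) :
  (0 < d)%N -> (1 < t)%N -> (0 < n1)%N -> (n2 <= (d * t).+1)%N ->
  \sum_(n1 <= x < n2 | gcdn x (d * t) == d) G x =
  \sum_(u : {unit 'Z_t} | (n1 <= d * val u < n2)%N) G (d * val u)%N.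
Proof.
move=> d0 t1 n10 n2t.
rewrite -big_filter -[RHS]big_filter.
rewrite -[RHS](big_map (fun u : {unit 'Z_t} => (d * val u)%N) xpredT G).
apply: perm_big; apply: uniq_perm.
- by rewrite filter_uniq ?iota_uniq.
- rewrite map_inj_uniq ?filter_uniq ?index_enum_uniq // => u w /eqP.
  by rewrite eqn_pmul2l // => /eqP /val_inj /val_inj.
move=> x; rewrite mem_filter mem_index_iota; apply/andP/mapP => [[/eqP gx xr]|[u]].
  have [x' ex] : exists x', x = (d * x')%N.
    by exists (x %/ d)%N; rewrite mulnC divnK // -gx dvdn_gcdl.
  have cx : coprime t x'.
    by move: gx; rewrite ex -muln_gcdr -{2}[d]muln1 => /eqP; rewrite eqn_pmul2l // gcdnC.
  have x't : (x' < t)%N.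
    rewrite ltn_neqAle; apply/andP; split.
      by apply: contraTneq cx => ->; rewrite /coprime gcdnn gtn_eqF.
    by rewrite -(leq_pmul2l d0) -ex -ltnS; case/andP: xr => _ /leq_trans; apply.
  have ku : (x'%:R : 'Z_t) \is a GRing.unit by rewrite unitZpE.
  have vk : (x'%:R : 'Z_t) = x' :> nat by rewrite val_Zp_nat // modn_small.
  exists (FinRing.unit 'Z_t ku); last by rewrite /= vk.
  by rewrite mem_filter mem_index_enum andbT /= vk -ex.
rewrite mem_filter => /andP[ur _] ->; split=> //.
rewrite -muln_gcdr -{2}[d]muln1 eqn_pmul2l // gcdnC -/(coprime _ _) -unitZpE //.
by rewrite natr_Zp (valP u).
Qed.

Section BilinearBound.

Variables (R : realType) (p : nat) (p_pr : prime p) (gam a : 'F_p) (psi : 'F_p -> R[i]).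
Hypotheses (gam_prim : p.-1.-primitive_root gam) (a0 : a != 0).
Hypotheses (psiD : {morph psi : x y / x + y >-> x * y}) (psi0 : psi 0 = 1)
  (psi_norm : forall x, normc (psi x) = 1) (psi_nontriv : exists b, psi b != 1).
Local Notation C := (R[i]).
Local Notation T := p.-1.
Local Notation tau := (size (divisors T)).
Local Notation q := (Num.sqrt (Num.sqrt p%:R) : R).

Section Rows.

Variables (al : nat -> C) (L M : nat).
Hypotheses (al1 : forall x, (L + 1 <= x <= L + M)%N -> normc (al x) <= 1)
  (M0 : (0 < M)%N) (LM : (L + M <= T)%N).

Let cls d y := \sum_(L + 1 <= x < (L + M).+1 | gcdn x T == d) al x * psi (a * gam ^+ (x * y)).

Lemma row_class_bound d : (d %| T)%N ->
  \sum_(0 <= y < T) normc (cls d y) ^+ 2 <= 10 * tau%:R ^+ 2 * q ^+ 5 * Num.sqrt M%:R ^+ 3.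
Proof.
move=> dT; pose t := (T %/ d)%N; have T0 : (0 < T)%N by apply: prim_order_gt0 gam_prim.
have dt : (d * t = T)%N by rewrite mulnC divnK.
have d0 : (0 < d)%N := dvdn_gt0 T0 dT.
have t0 : (0 < t)%N by rewrite divn_gt0 // dvdn_leq.
have tau1 : 1 <= tau%:R :> R.
  rewrite ler1n; have := divisor1 T; rewrite -has_pred1 has_count => h.
  by apply: leq_trans h (count_size _ _).
have tau2 : 1 <= tau%:R ^+ 2 :> R by rewrite -[X in X <= _](expr1n _ 2) ler_sqr ?nnegrE ?ler0n ?ler01.
have sM : 1 <= Num.sqrt M%:R :> R by rewrite -[X in X <= _]sqrtr1 ler_wsqrtr // ler1n.
have q1 : 1 <= q.
  by rewrite -[X in X <= _]sqrtr1 ler_wsqrtr // -[X in X <= _]sqrtr1 ler_wsqrtr // ler1n prime_gt0.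
have q4 : q ^+ 4 = p%:R by rewrite (exprM q 2 2) !sqr_sqrtr ?sqrtr_ge0 ?ler0n.
(* The type ['Z_t] has at least two elements, so t = 1 is separate: then the class contains at most
   x = T. *)
have [t1|t1] := leqP t 1.
  have tE : t = 1%N by apply/eqP; rewrite eqn_leq t1 t0.
  have dE : d = T by rewrite -dt tE muln1.
  have cls1 y : normc (cls d y) ^+ 2 <= 1.
    rewrite -[X in _ <= X](expr1n _ 2) ler_sqr ?nnegrE ?normc_ge0 ?ler01 //.
    apply: le_trans (ler_normc_sum _ _ _) _.
    apply: le_trans (_ : \sum_(L + 1 <= x < (L + M).+1 | gcdn x T == d) 1 <= _).
      rewrite big_nat_cond [X in _ <= X]big_nat_cond; apply: ler_sum => x /andP[xr _].
      by rewrite normcM psi_norm mulr1 al1.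
    rewrite -big_filter big_const_seq count_predT iter_addr_0 -[X in _ <= X]/(1%:R) ler_nat.
    apply: (@uniq_leq_size _ _ [:: T]); first by rewrite filter_uniq ?iota_uniq.
    move=> x; rewrite mem_filter mem_index_iota inE dE => /andP[/eqP gx /andP[x1 x2]].
    have Tx : (T %| x)%N by rewrite -{1}gx dvdn_gcdl.
    rewrite eqn_leq (leq_trans _ LM) //= dvdn_leq //.
    by apply: leq_trans x1; rewrite addn1.
  apply: le_trans (_ : T%:R <= _).
    rewrite -[X in X%:R]subn0 -[X in _ <= X]mulr1 mulr_natl -sumr_const_nat.
    exact: ler_sum.
  apply: le_trans (_ : q ^+ 4 <= _); first by rewrite q4 ler_nat leq_pred.
  have q0 : 0 <= q := sqrtr_ge0 _.
  have s3 : 1 <= Num.sqrt M%:R ^+ 3 :> R by rewrite exprn_ege1.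
  have h10 : 1 <= 10 * tau%:R ^+ 2 :> R by lra.
  have -> : 10 * tau%:R ^+ 2 * q ^+ 5 * Num.sqrt M%:R ^+ 3 =
      q ^+ 4 * (10 * tau%:R ^+ 2 * (q * Num.sqrt M%:R ^+ 3)) by ring.
  by rewrite ler_peMr ?exprn_ge0 // mulr_ege1 // mulr_ege1.
pose e (u : {unit 'Z_t}) := if (L + 1 <= d * val u < (L + M).+1)%N then al (d * val u)%N else 0.
have e1 u : normc (e u) <= 1.
  by rewrite /e; case: ifP => [h|_]; [apply: al1 | rewrite normc0 ler01].
have clsE y : cls d y = \sum_u e u * class_fun gam a psi d (val u * y%:R).
  rewrite /cls -{1}dt sum_gcd_class //; first last.
  - by rewrite dt ltnS.
  - by rewrite addn1.
  rewrite big_mkcond; apply: eq_bigr => u _; rewrite /e; case: ifP; rewrite ?mul0r // => _.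
  congr (_ * _); have -> : val u * y%:R = ((val u : nat) * y)%N%:R :> 'Z_t.
    by rewrite natrM natr_Zp.
  by rewrite (class_funE _ _ gam_prim dt t1) -exprM mulnA.
(* The T values of y run d times over the residues modulo t, which supplies the factor d in
   [class_bound]. *)
have per y : normc (cls d (y + t)) ^+ 2 = normc (cls d y) ^+ 2.
  by rewrite !clsE natrD pchar_Zp // addr0.
rewrite -{1}dt sum_periodic // -[_ *+ d]mulr_natl -(big_Zp (fun y => normc (cls d y) ^+ 2) t1).
under eq_bigr => v _ do rewrite clsE natr_Zp.
apply: le_trans (class_bound p_pr gam_prim a0 psiD psi0 psi_norm psi_nontriv dt t1 e1) _.

rewrite ler_wpM2l ?mulr_ge0 ?exprn_ge0 ?sqrtr_ge0 ?ler0n //.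
rewrite lerXn2r ?nnegrE ?sqrtr_ge0 // ler_wsqrtr //.
apply: le_trans (_ : \sum_(u : {unit 'Z_t} | (L + 1 <= d * val u < (L + M).+1)%N) 1 <= _).
  rewrite [X in _ <= X]big_mkcond; apply: ler_sum => u _.
  by move: (e1 u); rewrite /e; case: ifP => // _ _; rewrite normc0.
rewrite -(@sum_gcd_class _ (fun=> 1) d t (L + 1) (L + M).+1) ?addn1 ?dt //.
apply: le_trans (_ : \sum_(L.+1 <= x < (L + M).+1) 1 <= _).
  by rewrite [X in X <= _]big_mkcond; apply: ler_sum => x _; case: ifP.
by rewrite sumr_const_nat subSS addKn.
Qed.

(** Cauchy-Schwarz over the divisor classes loses one factor [tau], and adding up the class bounds
    another. *)
Lemma row_bound :
  \sum_(0 <= y < T)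
    normc (\sum_(L + 1 <= x < (L + M).+1) al x * psi (a * gam ^+ (x * y))) ^+ 2
  <= 10 * tau%:R ^+ 4 * q ^+ 5 * Num.sqrt M%:R ^+ 3.
Proof.
have T0 : (0 < T)%N by apply: prim_order_gt0 gam_prim.
have rowE y : \sum_(L + 1 <= x < (L + M).+1) al x * psi (a * gam ^+ (x * y)) =
    \sum_(d <- divisors T) 1 * cls d y.
  under [RHS]eq_bigr do rewrite mul1r /cls big_mkcond.
  rewrite exchange_big; apply: eq_bigr => x _ /=.
  rewrite (bigD1_seq (gcdn x T)) ?divisors_uniq //= -?dvdn_divisors ?dvdn_gcdr //.
  by rewrite eqxx big1 ?addr0 // => d; rewrite eq_sym => /negbTE ->.
have step y : normc (\sum_(L + 1 <= x < (L + M).+1) al x * psi (a * gam ^+ (x * y))) ^+ 2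
    <= tau%:R * \sum_(d <- divisors T) normc (cls d y) ^+ 2.
  rewrite rowE; apply: le_trans (cauchy_schwarz_normc _ _ _ _) _.
  under eq_bigr do rewrite normc1 expr1n.
  by rewrite big_const_seq count_predT iter_addr_0.
apply: le_trans (ler_sum _ (fun y _ => step y)) _.
rewrite -mulr_sumr exchange_big /=.
have -> : 10 * tau%:R ^+ 4 * q ^+ 5 * Num.sqrt M%:R ^+ 3 =
    tau%:R * (tau%:R * (10 * tau%:R ^+ 2 * q ^+ 5 * Num.sqrt M%:R ^+ 3)) by ring.
rewrite ler_wpM2l // mulr_natl -iter_addr_0 -(count_predT (divisors T)) -(big_const_seq _ _ (divisors T)).
rewrite big_seq [X in _ <= X]big_seq; apply: ler_sum => d dd.
by apply: row_class_bound; rewrite dvdn_divisors.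
Qed.

End Rows.

Lemma bilinear_rows (al be : nat -> C) (K N L M : nat) :
  (forall x, (L + 1 <= x <= L + M)%N -> normc (al x) <= 1) ->
  (forall y, (K + 1 <= y <= K + N)%N -> normc (be y) <= 1) ->
  (0 < M)%N -> (L + M <= T)%N -> (K + N <= T)%N ->
  normc (\sum_(L + 1 <= x < (L + M).+1) \sum_(K + 1 <= y < (K + N).+1)
    al x * be y * psi (a * gam ^+ (x * y))) ^+ 2 <=
  N%:R * (10 * tau%:R ^+ 4 * q ^+ 5 * Num.sqrt M%:R ^+ 3).
Proof.
move=> al1 be1 M0 LM KN.
pose r y := \sum_(L + 1 <= x < (L + M).+1) al x * psi (a * gam ^+ (x * y)).
have -> : \sum_(L + 1 <= x < (L + M).+1) \sum_(K + 1 <= y < (K + N).+1)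
    al x * be y * psi (a * gam ^+ (x * y)) = \sum_(K + 1 <= y < (K + N).+1) be y * r y.
  rewrite exchange_big; apply: eq_bigr => y _; rewrite /r mulr_sumr.
  by apply: eq_bigr => x _; rewrite mulrCA mulrA.
apply: le_trans (cauchy_schwarz_normc _ _ _ _) _.
apply: ler_pM; try by apply: sumr_ge0 => y _; apply: sqr_ge0.
  apply: le_trans (_ : \sum_(K + 1 <= y < (K + N).+1) 1 <= _).
    rewrite big_nat [X in _ <= X]big_nat; apply: ler_sum => y hy.
    by rewrite -[X in _ <= X](expr1n _ 2) ler_sqr ?nnegrE ?normc_ge0 ?ler01 // be1.
  by rewrite sumr_const_nat addn1 subSS addKn.
apply: le_trans (row_bound al1 M0 LM).
(* The rows 1..T and 0..T-1 cover the same full period. *)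
have rT : r T = r 0%N.
  apply: eq_bigr => x _; rewrite muln0 expr0 mulnC exprM.
  by rewrite (prim_expr_order gam_prim) expr1n.
rewrite addn1; apply: le_trans (_ : \sum_(1 <= y < T.+1) normc (r y) ^+ 2 <= _).
  have k2 : (K.+1 <= T.+1)%N by rewrite ltnS (leq_trans _ KN) ?leq_addr.
  have k3 : (K.+1 <= (K + N).+1)%N by rewrite ltnS leq_addr.
  have k4 : ((K + N).+1 <= T.+1)%N by rewrite ltnS.
  rewrite (big_cat_nat (isT : (1 <= K.+1)%N) k2) (big_cat_nat k3 k4) /=.
  by rewrite addrCA lerDl addr_ge0 // sumr_ge0 // => y _; apply: sqr_ge0.
have T0 : (0 < T)%N by apply: prim_order_gt0 gam_prim.
by rewrite big_nat_recr //= rT addrC [X in _ <= X]big_ltn.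
Qed.

(** The row estimate favours the shorter x-range, so x and y are exchanged if M > N. Then sqrt M <=
    (N M)^(1/4), which makes the bound symmetric. *)
Lemma bilinear_bound (al be : nat -> C) (K N L M : nat) :
  (forall x, (L + 1 <= x <= L + M)%N -> normc (al x) <= 1) ->
  (forall y, (K + 1 <= y <= K + N)%N -> normc (be y) <= 1) ->
  (0 < M)%N -> (0 < N)%N -> (L + M <= T)%N -> (K + N <= T)%N ->
  normc (\sum_(L + 1 <= x < (L + M).+1) \sum_(K + 1 <= y < (K + N).+1)
    al x * be y * psi (a * gam ^+ (x * y))) ^+ 2 <=
  10 * tau%:R ^+ 4 * (q * Num.sqrt (Num.sqrt (N * M)%:R)) ^+ 5.
Proof.
wlog MN : al be K N L M / (M <= N)%N.
  move=> hw al1 be1 M0 N0 LM KN; case/orP: (leq_total M N) => h; first exact: hw.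
  rewrite exchange_big /= mulnC.
  under eq_bigr do under eq_bigr do rewrite [al _ * _]mulrC mulnC.
  exact: hw.
move=> al1 be1 M0 N0 LM KN; apply: le_trans (bilinear_rows al1 be1 M0 LM KN) _.
set n := Num.sqrt N%:R : R; set m := Num.sqrt M%:R : R; set r := Num.sqrt (Num.sqrt (N * M)%:R) : R.
have n2 : N%:R = n ^+ 2 by rewrite sqr_sqrtr.
have r2 : r ^+ 2 = n * m by rewrite sqr_sqrtr ?sqrtr_ge0 // natrM sqrtrM.
have mn : m <= n by rewrite ler_wsqrtr // ler_nat.
have m0 : 0 <= m := sqrtr_ge0 _.
have r0 : 0 <= r := sqrtr_ge0 _.
have mr : m <= r by rewrite -ler_sqr ?nnegrE // r2 expr2 ler_wpM2r.
have q0 : 0 <= q := sqrtr_ge0 _.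
have -> : 10 * tau%:R ^+ 4 * (q * r) ^+ 5 = 10 * tau%:R ^+ 4 * q ^+ 5 * ((r ^+ 2) ^+ 2 * r) by ring.
rewrite r2 n2.
have -> : n ^+ 2 * (10 * tau%:R ^+ 4 * q ^+ 5 * m ^+ 3) =
    10 * tau%:R ^+ 4 * q ^+ 5 * ((n * m) ^+ 2 * m) by ring.
by rewrite ler_wpM2l ?mulr_ge0 ?exprn_ge0 ?ler0n // ler_wpM2l // sqr_ge0.
Qed.

End BilinearBound.

Local Open Scope complex_scope.

(** * The additive character modulo p *)

Section AdditiveCharacter.

Variables (R : realType) (p : nat) (p_pr : prime p).

Definition cis (x : R) : R[i] := cos x +i* sin x.

Lemma cisD x y : cis (x + y) = cis x * cis y.
Proof.
rewrite /cis cosD sinD; apply/eqP; rewrite eq_complex /=.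
by apply/andP; split=> //; apply/eqP; rewrite addrC.
Qed.

Lemma cis0 : cis 0 = 1.
Proof. by rewrite /cis cos0 sin0. Qed.

Lemma normc_cis x : normc (cis x) = 1.
Proof. by rewrite /= cos2Dsin2 sqrtr1. Qed.

Lemma cis_2pi_nat (n : nat) : cis (2 * pi * n%:R) = 1.
Proof.
elim: n => [|n IH]; first by rewrite mulr0 cis0.
rewrite -(natr1 n) mulrDr cisD IH mul1r mulr1 /cis mulr_natl.
by rewrite cos2pi sin2pi.
Qed.

Lemma epE (x : R) : ep p (x%:C) = cis (2 * pi * (x / p%:R)).
Proof.
have pE : (p%:R)^-1 = ((p%:R)^-1 : R)%:C by rewrite fmorphV rmorph_nat.
have -> : ep p x%:C = cexp (0 +i* (2 * pi * (x / p%:R))).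
  rewrite /ep pE; congr cexp; apply/eqP; rewrite eq_complex /=.
  by apply/andP; split; apply/eqP; rewrite ?mulr0 ?mul0r ?mulr1 ?subr0 ?addr0 ?add0r; ring.
by rewrite /cexp /= expR0 mul1r.
Qed.

Definition psi (c : 'F_p) : R[i] := cis (2 * pi * ((c : nat)%:R / p%:R)).

Let p0 : p%:R != 0 :> R.
Proof. by rewrite pnatr_eq0 -lt0n prime_gt0. Qed.

Lemma cis_modn (n : nat) : cis (2 * pi * (n%:R / p%:R)) = psi n%:R.
Proof.
have nE : n%:R / p%:R = (n %/ p)%:R + (n %% p)%:R / p%:R :> R.
  by rewrite {1}(divn_eq n p) natrD natrM mulrDl mulfK.
by rewrite /psi val_Fp_nat // nE mulrDr cisD cis_2pi_nat mul1r.
Qed.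

Lemma psiD : {morph psi : x y / x + y >-> x * y}.
Proof.
move=> x y; have -> : x + y = ((x : nat) + (y : nat))%N%:R by rewrite natrD !natr_Zp.
by rewrite -cis_modn [X in X / _]natrD [X in 2 * pi * X]mulrDl mulrDr cisD.
Qed.

Lemma psi0 : psi 0 = 1.
Proof. by rewrite /psi mul0r mulr0 cis0. Qed.

Lemma normc_psi c : normc (psi c) = 1.
Proof. exact: normc_cis. Qed.

Lemma psi_nontriv : exists b, psi b != 1.
Proof.
exists 1; have p1 := prime_gt1 p_pr.
have -> : psi 1 = cis (2 * pi * (1 / p%:R)) by exact: esym (cis_modn 1).
apply/eqP => /(congr1 (@complex.Re R)) /=; rewrite -[RHS]cos0 => /cos_inj.
have pR : 0 < p%:R :> R by rewrite ltr0n prime_gt0.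
have p2 : 2 <= p%:R :> R by rewrite ler_nat.
have pi0 := pi_gt0 R.
(* The angle 2 pi / p lies in the interval from 0 to pi, also for p = 2, and cos is injective
   there. *)
have x0 : 0 < 2 * pi * (1 / p%:R) :> R by rewrite !mulr_gt0 ?invr_gt0.
have xpi : 2 * pi * (1 / p%:R) <= pi :> R.
  by rewrite mul1r ler_pdivrMr // mulrC ler_pM2l.
rewrite !in_itv /= !lexx (ltW x0) xpi (ltW pi0) => /(_ isT isT) e.
by rewrite e ltxx in x0.
Qed.

Lemma ep_int (z : int) : ep p z%:~R = psi z%:~R.
Proof.
have -> : (z%:~R : R[i]) = (z%:~R : R)%:C by rewrite rmorph_int.
rewrite epE; case: z => n; first by rewrite -cis_modn.
have e : cis (2 * pi * ((n.+1)%:R / p%:R)) * cis (2 * pi * ((Negz n)%:~R / p%:R)) = 1.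
  by rewrite -cisD -mulrDr -mulrDl NegzE mulrNz subrr mul0r mulr0 cis0.
have e' : psi (n.+1)%:R * psi (Negz n)%:~R = 1.
  by rewrite -psiD NegzE mulrNz subrr psi0.
rewrite cis_modn in e; rewrite -e' in e; apply: mulfI e.
by rewrite -normc_eq0 normc_psi oner_eq0.
Qed.

End AdditiveCharacter.

(** * Extraction of the exponents and conclusion *)

(** The divisor bound is taken with eta / 2 because [tau] enters to the fourth power and a square
    root follows; 4 is an upper bound for sqrt 10. *)
Lemma bilinear_exponents (R : realType) (eta c tau X P S : R) :
  0 < c -> 0 <= X -> 0 < P -> 0 <= tau -> tau <= c * P `^ (eta / 2) -> 0 <= S ->
  S ^+ 2 <= 10 * tau ^+ 4 * (Num.sqrt (Num.sqrt P) * Num.sqrt (Num.sqrt X)) ^+ 5 ->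
  S <= 4 * c ^+ 2 * (X `^ (5 / 8) * P `^ (5 / 8 + eta)).
Proof.
move=> c0 X0 P0 t0 tauc S0 hS.
have sE (x : R) : 0 <= x -> Num.sqrt (Num.sqrt x) ^+ 5 = (x `^ (5 / 8)) ^+ 2.
  move=> x0; rewrite -(powR12_sqrt (sqrtr_ge0 x)) -(powR12_sqrt x0).
  rewrite -(powR_mulrn 5%N (powR_ge0 _ _)) -(powR_mulrn 2%N (powR_ge0 _ _)) -!powRrM.
  by congr (_ `^ _); field.
rewrite exprMn !sE ?(ltW P0) // in hS.
have tau4 : tau ^+ 4 <= c ^+ 4 * (P `^ eta) ^+ 2.
  apply: le_trans (_ : (c * P `^ (eta / 2)) ^+ 4 <= _).
    by apply: lerXn2r => //; rewrite nnegrE // mulr_ge0 ?powR_ge0 // ltW.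
  rewrite exprMn ler_pM2l ?exprn_gt0 //.
  rewrite -(powR_mulrn 4%N (powR_ge0 _ _)) -(powR_mulrn 2%N (powR_ge0 _ _)) -!powRrM.
  by rewrite le_eqVlt; apply/orP; left; apply/eqP; congr (_ `^ _); field.
rewrite powRD; last by rewrite (gt_eqF P0) implybT.
set u := X `^ _ in hS *; set v := P `^ _ in hS *; set w := P `^ eta in tau4 *.
have u0 : 0 <= u := powR_ge0 _ _.
have v0 : 0 <= v := powR_ge0 _ _.
have w0 : 0 <= w := powR_ge0 _ _.
have rhs0 : 0 <= 4 * c ^+ 2 * (u * (v * w)).
  by apply: mulr_ge0; apply: mulr_ge0 => //; [apply: exprn_ge0; apply: ltW | apply: mulr_ge0].
rewrite -ler_sqr ?nnegrE //; apply: le_trans hS _.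
have -> : (4 * c ^+ 2 * (u * (v * w))) ^+ 2 = 16 * (c ^+ 4 * w ^+ 2) * (v ^+ 2 * u ^+ 2) by ring.
apply: ler_wpM2r; first by rewrite mulr_ge0 // sqr_ge0.
have : 0 <= c ^+ 4 * w ^+ 2 by apply: mulr_ge0; apply: exprn_ge0; rewrite // ltW.
by move: tau4; move: (tau ^+ 4) (c ^+ 4 * w ^+ 2) => y z; lra.
Qed.

Theorem corollary3 (R : realType) (eta : R) (heta : 0 < eta) :
  exists C : R,
    forall (p : nat) (g a : int) (K N L M : nat) (alpha beta : nat -> R[i]),
      prime p ->
      primitive_root_mod p g ->
      coprimez a p ->
      (0 < K + 1 <= K + N)%N -> (K + N <= p - 1)%N ->
      (0 < L + 1 <= L + M)%N -> (L + M <= p - 1)%N ->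
      (forall x : nat, (L + 1 <= x <= L + M)%N -> `|alpha x| <= 1) ->
      (forall y : nat, (K + 1 <= y <= K + N)%N -> `|beta y| <= 1) ->
      `| \sum_(L + 1 <= x < (L + M).+1) \sum_(K + 1 <= y < (K + N).+1)
           alpha x * beta y * ep p (a * g ^+ (x * y))%:~R |
      <= (C * ((N * M)%:R `^ (5 / 8) * p%:R `^ (5 / 8 + eta)))%:C.
Proof.
have heta2 : 0 < eta / 2 by rewrite divr_gt0.
have [c c0 hc] := divisor_bound heta2.
exists (4 * c ^+ 2) => p g a K N L M alpha beta p_pr hg ha hK KN hL LM al1 be1.
have M0 : (0 < M)%N by move: hL; lia.
have N0 : (0 < N)%N by move: hK; lia.
rewrite subn1 in KN LM.
have a0 : (a%:~R : 'F_p) != 0.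
  apply: contraTneq ha => a0.
  have : (p %| a)%Z by rewrite (dvdz_pcharf (pchar_Fp p_pr)) a0.
  rewrite dvdzE /coprimez /gcdz /= => /gcdn_idPr ->.
  by rewrite -[1]/(1%N%:Z) eqz_nat gtn_eqF // prime_gt1.
have T0 : (0 < p.-1)%N by apply: prim_order_gt0 hg.
have nle1 (z : R[i]) : `|z| <= 1 -> normc z <= 1 by rewrite normC_normc -(lecR _ 1).
have := bilinear_bound p_pr hg a0 (@psiD R p p_pr) (@psi0 R p) (@normc_psi R p)
  (@psi_nontriv R p p_pr) (fun x h => nle1 _ (al1 x h)) (fun y h => nle1 _ (be1 y h)) M0 N0 LM KN.
rewrite normC_normc lecR.
have -> : \sum_(L + 1 <= x < (L + M).+1) \sum_(K + 1 <= y < (K + N).+1)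
           alpha x * beta y * ep p (a * g ^+ (x * y))%:~R =
   \sum_(L + 1 <= x < (L + M).+1) \sum_(K + 1 <= y < (K + N).+1)
           alpha x * beta y * @psi R p (a%:~R * g%:~R ^+ (x * y)).
  by apply: eq_bigr => x _; apply: eq_bigr => y _; rewrite ep_int // rmorphM rmorphXn.
move=> hS; apply: bilinear_exponents hS => //.
- by rewrite ltr0n prime_gt0.
- apply: le_trans (hc _ T0) _; rewrite ler_pM2l //.
  by apply: ge0_ler_powR; rewrite ?nnegrE ?ler0n ?ltW // ltr_nat prednK // prime_gt0.
- exact: normc_ge0.
Qed.
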